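(* Let $M^5(c)$ be a $5$-dimensional cosymplectic space form with structure $(\phi,\xi,\eta,g)$ and constant $\phi$-sectional curvature $c$, let $(N^3,g_N)$ be a $3$-dimensional Riemannian manifold, and let $F:M^5(c)\to N^3$ be a proper slant Riemannian submersion with slant angle $\theta$ such that $\xi$ is horizontal. Then at every point of every fibre $$\|H\|^2\ \ge\ \frac14\left(\hat\tau-\frac{c}{4}\left(1+3\cos^2\theta\right)\right),$$ where $H$ is the mean curvature vector field of the fibres and $\hat\tau$ is the scalar curvature of the fibre. Moreover, equality holds at a point $p$ of a fibre if and only if, with respect to some suitable slant orthonormal basis $$\{e_1,\ e_2=\sec\theta\,\psi e_1,\ e_3=\csc\theta\,\omega e_1,\ e_4=\csc\theta\,\omega e_2,\ e_5=\xi\}$$ at $p$, one has $$T^4_{11}=-T^4_{22},\qquad T^3_{11}=T^3_{12}=T^3_{22}=0=T^5_{ij},$$ where $T^\alpha_{ij}=g(\mathcal T(e_i,e_j),e_\alpha)$ for $1\le i,j\le 2$ and $3\le\alpha\le 5$.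
   Context: An almost contact metric structure $(\phi,\xi,\eta,g)$ on an odd-dimensional manifold $M$ consists of a $(1,1)$-tensor $\phi$, a vector field $\xi$, a $1$-form $\eta$ and a Riemannian metric $g$ with $\phi^2=-I+\eta\otimes\xi$, $\phi\xi=0$, $\eta\circ\phi=0$, $\eta(\xi)=1$, $g(\phi X,\phi Y)=g(X,Y)-\eta(X)\eta(Y)$, $\eta(X)=g(X,\xi)$. It is cosymplectic if it is normal and $\eta$ and $\Phi(X,Y)=g(X,\phi Y)$ are closed; the structure equation is $\nabla\phi=0$, and then $\nabla\xi=0$ ($\nabla$ the Levi-Civita connection). The $\phi$-sectional curvature is $H(E)=g(R(E,\phi E)\phi E,E)$ for unit $E\perp\xi$; a cosymplectic space form $M(c)$ is a cosymplectic manifold with constant $\phi$-sectional curvature $c$. A Riemannian submersion $F:(M,g_M)\to(N,g_N)$ is a smooth surjective map of maximal rank such that $F_*$ preserves the lengths of horizontal vectors. Vertical means tangent to the fibres (in $\ker F_*$), horizontal means in $(\ker F_* )^\perp$; $\mathcal V,\mathcal H$ are the corresponding orthogonal projections. O'Neill's tensor is $\mathcal T(E,G)=\mathcal T_EG=\mathcal H\nabla_{\mathcal VE}\mathcal VG+\mathcal V\nabla_{\mathcal VE}\mathcal HG$. For vertical $U$ write $\phi U=\psi U+\omega U$ with $\psi U$ vertical and $\omega U$ horizontal. $F$ (with $\xi$ horizontal) is slant if for every nonzero vertical vector $X$ the angle between $\phi X$ and $\ker F_*$ is a constant $\theta$ (the slant angle) independent of the point and of $X$. It is invariant if $\theta=0$,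 anti-invariant if $\theta=\pi/2$, and proper if it is neither. Here the fibres are $2$-dimensional, $H=\frac12\sum_{j=1}^2\mathcal T_{U_j}U_j$ for a local orthonormal frame $U_1,U_2$ of $\ker F_*$, and $\hat\tau=\hat K(U_1\wedge U_2)$, where $\hat K$ is the sectional curvature of the fibre with the induced metric. A slant orthonormal basis at $p$ is an orthonormal basis of the form displayed in the claim. *)

(* Defs.v *)
From HB Require Import structures.
From mathcomp Require Import all_boot all_order all_algebra.
From mathcomp Require Import all_classical all_reals all_analysis.

Set Implicit Arguments.
Unset Strict Implicit.
Unset Printing Implicit Defensive.

Import Order.TTheory GRing.Theory Num.Theory.
Import numFieldNormedType.Exports.

Local Open Scope classical_set_scope.
Local Open Scope ring_scope.

(* Manifolds are given by smooth atlases and tensor fields by their component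
   functions in the charts, subject to the usual transformation laws.
   Tangent vectors are ROW vectors of components, so that a linear map acts by
   multiplication on the right: [v *m jacobian f x] is the image of [v] under
   the differential of [f] at [x].  Component functions are total on R^n, but
   only their values on the (open) images of the charts are meaningful. *)

Section Calculus.
Context {R : realType} {n : nat}.

Definition basis_vec (a : 'I_n) : 'rV[R]_n := delta_mx 0 a.

Fixpoint times_differentiable_on (k : nat) (m p : nat) (U : set 'rV[R]_n)
    (f : 'rV[R]_n -> 'M[R]_(m, p)) : Prop :=
  if k is k'.+1 then
    (forall x, U x -> differentiable f x) /\
    (forall a, times_differentiable_on k' U (fun x => 'D_(basis_vec a) f x))
  else True.

(* Infinite differentiability on an open set U. *)
Definition smooth_on (m p : nat) (U : set 'rV[R]_n)
    (f : 'rV[R]_n -> 'M[R]_(m, p)) : Prop :=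
  forall k, times_differentiable_on k U f.

End Calculus.

(* A second countable Hausdorff smooth manifold without boundary.  The atlas is
   not required to be maximal: any atlas determines the smooth structure. *)
Record manifold (R : realType) (n : nat) := Manifold {
  mpoint :> topologicalType;
  mpoint_hausdorff : hausdorff_space mpoint;
  mpoint_second_countable : @second_countable mpoint;
  chart : Type;
  dom : chart -> set mpoint;
  chart_map : chart -> mpoint -> 'rV[R]_n;
  chart_inv : chart -> 'rV[R]_n -> mpoint;
  dom_open : forall i, open (dom i);
  dom_cover : forall p, exists i, dom i p;
  img_open : forall i, open (chart_map i @` dom i);
  chart_mapK : forall i p, dom i p -> chart_inv i (chart_map i p) = p;
  chart_map_continuous : forall i p, dom i p -> {for p, continuous (chart_map i)};
  chart_inv_continuous : forall i x, (chart_map i @` dom i) x ->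
    {for x, continuous (chart_inv i)};
  transition_smooth : forall i j,
    smooth_on (chart_map i @` (dom i `&` dom j)) (chart_map j \o chart_inv i)
}.

Arguments chart {R n} m.
Arguments dom {R n m} _ _.
Arguments chart_map {R n m} _ _.
Arguments chart_inv {R n m} _ _.

Definition img {R : realType} {n : nat} {M : manifold R n} (i : chart M) :
  set 'rV[R]_n := chart_map i @` dom i.

Definition overlap {R : realType} {n : nat} {M : manifold R n}
  (i j : chart M) : set 'rV[R]_n := chart_map i @` (dom i `&` dom j).

Definition transition {R : realType} {n : nat} {M : manifold R n}
  (i j : chart M) : 'rV[R]_n -> 'rV[R]_n := chart_map j \o chart_inv i.

(* The value at (v, w) of the bilinear form with Gram matrix b. *)
Definition ip {R : realType} {n : nat} (b : 'M[R]_n) (v w : 'rV[R]_n) : R :=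
  (v *m b *m w^T) 0 0.

Record metric {R : realType} {n : nat} (M : manifold R n) := Metric {
  gram :> chart M -> 'rV[R]_n -> 'M[R]_n;
  gram_smooth : forall i, smooth_on (img i) (gram i);
  gram_change : forall i j x, overlap i j x ->
    let J := jacobian (transition i j) x in
    gram i x = J *m gram j (transition i j x) *m J^T;
  gram_sym : forall i x, img i x -> (gram i x)^T = gram i x;
  gram_pos : forall i x, img i x -> forall v, v != 0 -> 0 < ip (gram i x) v v
}.

Section LocalGeometry.
Context {R : realType} {n : nat}.
Implicit Types (g : 'rV[R]_n -> 'M[R]_n) (X Y Z : 'rV[R]_n -> 'rV[R]_n).
Implicit Types x u v w : 'rV[R]_n.

(* Christoffel symbols of the Levi-Civita connection of g, contracted with u
   and v: the components are u^a v^b Gamma_{ab}^k, where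
   Gamma_{ab}^k = 1/2 g^{kl} (d_a g_{bl} + d_b g_{al} - d_l g_{ab}). *)
Definition christoffel g x u v : 'rV[R]_n :=
  (2^-1 *: \row_l (ip ('D_u g x) v (basis_vec l) + ip ('D_v g x) u (basis_vec l)
                   - ip ('D_(basis_vec l) g x) u v)) *m invmx (g x).

Definition nabla g X Y : 'rV[R]_n -> 'rV[R]_n :=
  fun x => 'D_(X x) Y x + christoffel g x (X x) (Y x).

Definition lie_bracket X Y : 'rV[R]_n -> 'rV[R]_n :=
  fun x => 'D_(X x) Y x - 'D_(Y x) X x.

(* R(X, Y) Z, with R(X, Y) = [nabla_X, nabla_Y] - nabla_[X, Y]. *)
Definition riemann g X Y Z : 'rV[R]_n -> 'rV[R]_n :=
  fun x => nabla g X (nabla g Y Z) x - nabla g Y (nabla g X Z) x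
           - nabla g (lie_bracket X Y) Z x.

(* R is tensorial, so vectors at x may be extended to fields arbitrarily; they
   are extended here with constant components. *)
Definition curvature g x u v w : 'rV[R]_n :=
  riemann g (cst u) (cst v) (cst w) x.

Definition sectional g x u v : R :=
  ip (g x) (curvature g x u v v) u /
  (ip (g x) u u * ip (g x) v v - ip (g x) u v ^+ 2).

(* b is an inner product; as 0^-1 = 0 and acos 0 = pi / 2, the zero vector is at
   angle pi / 2 with every vector. *)
Definition angle (b : 'M[R]_n) v w : R :=
  acos (ip b v w / (Num.sqrt (ip b v v) * Num.sqrt (ip b w w))).

(* Exterior derivatives of a 1-form eta and a 2-form Om, given as functions of
   vector fields, with the normalization in which normality of an almost contact
   structure reads [phi, phi] + 2 d eta (x) xi = 0. *)
Definition ext_deriv1 (eta : ('rV[R]_n -> 'rV[R]_n) -> 'rV[R]_n -> R) X Y x : R :=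
  2^-1 * ('D_(X x) (eta Y) x - 'D_(Y x) (eta X) x - eta (lie_bracket X Y) x).

Definition ext_deriv2
    (Om : ('rV[R]_n -> 'rV[R]_n) -> ('rV[R]_n -> 'rV[R]_n) -> 'rV[R]_n -> R)
    X Y Z x : R :=
  3^-1 * ('D_(X x) (Om Y Z) x + 'D_(Y x) (Om Z X) x + 'D_(Z x) (Om X Y) x
          - Om (lie_bracket X Y) Z x - Om (lie_bracket Y Z) X x
          - Om (lie_bracket Z X) Y x).

End LocalGeometry.

(* The endomorphism phi maps v to [v *m phi]; the vector eta is a column, so that
   eta(v) is the entry of [v *m eta].  With these conventions the fields phi_sq,
   ..., eta_gram say phi^2 = -I + eta (x) xi, phi xi = 0, eta o phi = 0,
   eta(xi) = 1, g(phi X, phi Y) = g(X, Y) - eta(X) eta(Y), eta(X) = g(X, xi). *)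
Record almost_contact_metric {R : realType} {n : nat} (M : manifold R n) :=
  AlmostContactMetric {
  acm_metric :> metric M;
  phi : chart M -> 'rV[R]_n -> 'M[R]_n;
  xi : chart M -> 'rV[R]_n -> 'rV[R]_n;
  eta : chart M -> 'rV[R]_n -> 'cV[R]_n;
  phi_smooth : forall i, smooth_on (img i) (phi i);
  xi_smooth : forall i, smooth_on (img i) (xi i);
  eta_smooth : forall i, smooth_on (img i) (eta i);
  phi_change : forall i j x, overlap i j x ->
    let J := jacobian (transition i j) x in
    phi i x *m J = J *m phi j (transition i j x);
  xi_change : forall i j x, overlap i j x ->
    xi i x *m jacobian (transition i j) x = xi j (transition i j x);
  eta_change : forall i j x, overlap i j x ->
    eta i x = jacobian (transition i j) x *m eta j (transition i j x);
  phi_sq : forall i x, img i x ->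
    phi i x *m phi i x = - 1%:M + eta i x *m xi i x;
  phi_xi : forall i x, img i x -> xi i x *m phi i x = 0;
  eta_phi : forall i x, img i x -> phi i x *m eta i x = 0;
  eta_xi : forall i x, img i x -> xi i x *m eta i x = 1%:M;
  phi_gram : forall i x, img i x ->
    phi i x *m acm_metric i x *m (phi i x)^T =
    acm_metric i x - eta i x *m (eta i x)^T;
  eta_gram : forall i x, img i x -> eta i x = acm_metric i x *m (xi i x)^T
}.

Section Cosymplectic.
Context {R : realType} {n : nat} {M : manifold R n}.
Variable S : almost_contact_metric M.
Implicit Types (i : chart M) (X Y Z : 'rV[R]_n -> 'rV[R]_n).

Definition phi_field i X : 'rV[R]_n -> 'rV[R]_n := fun x => X x *m phi S i x.

Definition eta_form i X : 'rV[R]_n -> R := fun x => (X x *m eta S i x) 0 0.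

Definition fundamental_form i X Y : 'rV[R]_n -> R :=
  fun x => ip (S i x) (X x) (phi_field i Y x).

Definition nijenhuis i X Y : 'rV[R]_n -> 'rV[R]_n := fun x =>
  phi_field i (phi_field i (lie_bracket X Y)) x
  + lie_bracket (phi_field i X) (phi_field i Y) x
  - phi_field i (lie_bracket (phi_field i X) Y) x
  - phi_field i (lie_bracket X (phi_field i Y)) x.

Definition normal_structure : Prop := forall i X Y,
  smooth_on (img i) X -> smooth_on (img i) Y -> forall x, img i x ->
  nijenhuis i X Y x + (2 * ext_deriv1 (eta_form i) X Y x) *: xi S i x = 0.

Definition eta_closed : Prop := forall i X Y,
  smooth_on (img i) X -> smooth_on (img i) Y -> forall x, img i x ->
  ext_deriv1 (eta_form i) X Y x = 0.

Definition fundamental_form_closed : Prop := forall i X Y Z,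
  smooth_on (img i) X -> smooth_on (img i) Y -> smooth_on (img i) Z ->
  forall x, img i x -> ext_deriv2 (fundamental_form i) X Y Z x = 0.

Definition cosymplectic : Prop :=
  [/\ normal_structure, eta_closed & fundamental_form_closed].

Definition phi_sectional i x (E : 'rV[R]_n) : R :=
  ip (S i x) (curvature (S i) x E (E *m phi S i x) (E *m phi S i x)) E.

Definition cosymplectic_space_form (c : R) : Prop :=
  cosymplectic /\
  forall i x E, img i x -> ip (S i x) E E = 1 -> ip (S i x) E (xi S i x) = 0 ->
    phi_sectional i x E = c.

End Cosymplectic.

Section Submersion.
Context {R : realType} {n m : nat} {M : manifold R n} {N : manifold R m}.
Variables (gM : metric M) (gN : metric N) (F : M -> N).
Implicit Types (i : chart M) (j : chart N) (x v : 'rV[R]_n).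

Definition chart_rep i j : 'rV[R]_n -> 'rV[R]_m := chart_map j \o F \o chart_inv i.

Definition pushforward i j x : 'M[R]_(n, m) := jacobian (chart_rep i j) x.

Definition smooth_map : Prop :=
  continuous F /\
  forall i j, smooth_on (chart_map i @` (dom i `&` F @^-1` dom j)) (chart_rep i j).

Definition vertical i j x v : Prop := v *m pushforward i j x = 0.

Definition horizontal i j x v : Prop :=
  forall u, vertical i j x u -> ip (gM i x) u v = 0.

Definition riemannian_submersion : Prop :=
  [/\ smooth_map,
      forall q : N, exists p : M, F p = q
    & forall i j p, dom i p -> dom j (F p) ->
        let x := chart_map i p in
        \rank (pushforward i j x) = m /\
        forall v, horizontal i j x v ->
          ip (gN j (chart_map j (F p))) (v *m pushforward i j x)
                                    (v *m pushforward i j x) = ip (gM i x) v v].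

(* Row spaces of these matrices: ker F_* and its orthogonal complement. *)
Definition ver_mx i j x : 'M[R]_n := kermx (pushforward i j x).
Definition hor_mx i j x : 'M[R]_n := kermx (gM i x *m (ver_mx i j x)^T).

(* The orthogonal projections V and H. *)
Definition ver_proj i j x v : 'rV[R]_n :=
  v *m proj_mx (ver_mx i j x) (hor_mx i j x).
Definition hor_proj i j x v : 'rV[R]_n :=
  v *m proj_mx (hor_mx i j x) (ver_mx i j x).

Definition oneill_field i j (E G : 'rV[R]_n -> 'rV[R]_n) : 'rV[R]_n -> 'rV[R]_n :=
  let V X := fun y => ver_proj i j y (X y) in
  let H X := fun y => hor_proj i j y (X y) in
  fun x => hor_proj i j x (nabla (gM i) (V E) (V G) x)
           + ver_proj i j x (nabla (gM i) (V E) (H G) x).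

(* O'Neill's T is tensorial; as for the curvature, vectors at x are extended
   with constant components. *)
Definition oneill_T i j x (u : 'rV[R]_n) v : 'rV[R]_n :=
  oneill_field i j (cst u) (cst v) x.

(* h is the mean curvature vector at x of the 2-dimensional fibre through x. *)
Definition is_mean_curvature i j x (h : 'rV[R]_n) : Prop :=
  exists U1 U2 : 'rV[R]_n,
    [/\ vertical i j x U1 /\ vertical i j x U2,
        [/\ ip (gM i x) U1 U1 = 1, ip (gM i x) U2 U2 = 1
          & ip (gM i x) U1 U2 = 0]
      & h = 2^-1 *: (oneill_T i j x U1 U1 + oneill_T i j x U2 U2)].

(* s is, in the chart i, a parametrization near p of the 2-dimensional fibre
   through p: an immersion of an open set W of R^2 into M with values in the
   fibre, mapping u0 to p.  For a 2-dimensional fibre such an s is, near u0, the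
   inverse of a chart of the fibre. *)
Definition fibre_parametrization i (p : M) (W : set 'rV[R]_2)
    (s : 'rV[R]_2 -> 'rV[R]_n) (u0 : 'rV[R]_2) : Prop :=
  [/\ open W /\ W u0, smooth_on W s, s u0 = chart_map i p
    & forall u, W u ->
        [/\ img i (s u), F (chart_inv i (s u)) = F p
          & \rank (jacobian s u) = 2]].

Definition induced_metric i (s : 'rV[R]_2 -> 'rV[R]_n) : 'rV[R]_2 -> 'M[R]_2 :=
  fun u => jacobian s u *m gM i (s u) *m (jacobian s u)^T.

(* tau is the scalar curvature at p of the 2-dimensional fibre through p, i.e.
   the sectional curvature of its induced metric. *)
Definition is_fibre_scalar_curvature i (p : M) (tau : R) : Prop :=
  exists W s u0, fibre_parametrization i p W s u0 /\
    tau = sectional (induced_metric i s) u0 (basis_vec 0) (basis_vec 1).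

End Submersion.

Section Slant.
Context {R : realType} {n m : nat} {M : manifold R n} {N : manifold R m}.
Variables (S : almost_contact_metric M) (F : M -> N).
Implicit Types (i : chart M) (j : chart N) (x u v : 'rV[R]_n).

Definition psi i j x u : 'rV[R]_n := ver_proj S F i j x (u *m phi S i x).
Definition omega i j x u : 'rV[R]_n := hor_proj S F i j x (u *m phi S i x).

Definition xi_horizontal : Prop := forall i j p, dom i p -> dom j (F p) ->
  horizontal S F i j (chart_map i p) (xi S i (chart_map i p)).

(* The angle between phi X and ker F_* is the angle between phi X and its
   orthogonal projection psi X (pi / 2 when psi X = 0). *)
Definition slant (theta : R) : Prop := forall i j p, dom i p -> dom j (F p) ->
  let x := chart_map i p in
  forall X, X != 0 -> vertical F i j x X ->
    angle (S i x) (X *m phi S i x) (psi i j x X) = theta.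

Definition proper_slant (theta : R) : Prop :=
  [/\ slant theta, theta != 0 & theta != pi / 2].

Definition slant_orthonormal_basis (theta : R) i j x
    (e1 e2 e3 e4 e5 : 'rV[R]_n) : Prop :=
  [/\ vertical F i j x e1,
      e2 = (cos theta)^-1 *: psi i j x e1,
      e3 = (sin theta)^-1 *: omega i j x e1,
      e4 = (sin theta)^-1 *: omega i j x e2
    & e5 = xi S i x] /\
  let e := [tuple e1; e2; e3; e4; e5] in
  forall a b : 'I_5, ip (S i x) (tnth e a) (tnth e b) = (a == b)%:R.

End Slant.

(* Main.v *)
Require Import Defs.
From HB Require Import structures.
From mathcomp Require Import all_boot all_order all_algebra.
From mathcomp Require Import perm.
From mathcomp Require Import all_classical all_reals all_analysis.
From mathcomp Require Import ring lra.

(* By the Gauss equation along a parametrized fibre, the fibre has curvature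
   tau = K + <T11, T22> - |T12|^2, where K is the sectional curvature of M on
   the tangent plane of the fibre.  On a cosymplectic manifold phi is parallel,
   so on the orthogonal complement of xi the curvature has the symmetries of a
   Kaehler curvature tensor; constancy of the phi-sectional curvature then gives
   K = c / 4 (1 + 3 cos^2 theta) by polarization.  As H = (T11 + T22) / 2, the
   inequality is |T11|^2 + |T22|^2 + <T11, T22> + |T12|^2 >= 0, and equality
   holds iff T = 0 on vertical vectors.

   The conditions on the slant basis only seem to be weaker than T = 0: on the
   fibre <phi s_1, s_2>^2 = cos^2 theta |s_1 /\ s_2|^2 for a frame s_1, s_2, and
   differentiating this relation along the fibre gives
   <T(u, v), phi w> = <T(u, w), phi v>, hence T^3_12 = T^4_11 and
   T^3_22 = T^4_12, so that all the components vanish. *)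

Set Implicit Arguments.
Unset Strict Implicit.
Unset Printing Implicit Defensive.

Import Order.TTheory GRing.Theory Num.Theory.
Import numFieldNormedType.Exports.
Local Open Scope classical_set_scope.
Local Open Scope ring_scope.

(** * Calculus of matrix-valued functions *)

(** Component functions carry meaning only on open chart images, so identities are differentiated
    through local equality on an open set. Two notions of the statement resist direct computation.
    The projections come from kernel bases found by elimination, with no visible smoothness; they
    are replaced by a closed formula in the metric and the Jacobian of the submersion. The scalar
    curvature comes from some parametrization of the fibre, whose frame is not orthonormal and is
    unrelated to the frame defining H; so T at p is identified with the second fundamental form of
    that parametrization, and the Gauss equation is carried through a change of frame. Parallelism
    of phi is derived from normality and the closedness of eta and Phi. In the equality case every
    unit vertical vector generates a slant basis, so any one serves as a witness. *)

Lemma differentiable_near (R : realType) (V W : normedModType R) (f : V -> W) x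
    (e : R) : differentiable f x -> 0 < e ->
  \forall y \near x, `|f y - f x - 'd f x (y - x)| <= e * `|y - x|.
Proof.
move=> [[_]]; rewrite lim_id // => /eqaddoP h e0.
have := h _ e0; apply: filterS => y /=; rewrite !fctE opprD addrA.
exact.
Qed.

Lemma near_eq_differentiable (R : realType) (V W : normedModType R)
    (f g : V -> W) x :
  (\forall y \near x, f y = g y) -> differentiable f x -> differentiable g x.
Proof.
move=> fg df; have fgx := nbhs_singleton fg.
(* ['d g x] is picked by choice among the linear maps giving a first-order expansion, so exhibiting
   ['d f x] as one of them suffices. *)
apply/diffP; apply: (@getPex _ (fun dg : {linear V -> W} => continuous dg /\
  forall y, g y = g (lim (nbhs x)) + dg (y - lim (nbhs x))
                  +o_(y \near x) (y - lim (nbhs x)))).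
exists ('d f x); split; first exact: diff_continuous.
rewrite lim_id //.
suff : g = (fun y => g x + 'd f x (y - x)) +o_x (fun y => y - x).
  by rewrite {1}funeqE.
apply/eqaddoP => e /(differentiable_near df) h.
near=> y; rewrite /= !fctE opprD addrA -fgx -(near fg y) //.
by near: y.
Unshelve. all: by end_near. Qed.

Section MatrixCalculus.
Context {R : realType} {V : normedModType R}.
Implicit Types x v : V.

Lemma is_derive_mx m p (f : V -> 'M[R]_(m, p)) df x v :
  is_derive x v f df <-> forall i j, is_derive x v (fun y => f y i j) (df i j).
Proof.
split=> [[fxv <-] i j|h].
  by rewrite derive_mx// mxE; apply/derivableP;
    exact: ((derivable_mxP _ _ _).1 fxv).
have dfx : derivable f x v.
  by apply: (derivable_mxP _ _ _).2 => i j; case: (h i j).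
split=> //; rewrite derive_mx//; apply/matrixP => i j; rewrite mxE.
by case: (h i j).
Qed.

Lemma differentiable_mxP m p (f : V -> 'M[R]_(m, p)) x :
  differentiable f x <-> forall i j, differentiable (fun y => f y i j) x.
Proof.
split=> [df i j|h].
  exact: (differentiable_comp df (differentiable_coord _ i j)).
have -> : f = \sum_(i < m) \sum_(j < p) fun y => f y i j *: delta_mx i j.
  apply/funext => y; rewrite [LHS]matrix_sum_delta fct_sumE.
  by apply: eq_bigr => i _; rewrite fct_sumE.
by do 2!(apply: differentiable_sum => ?); exact: differentiableZl.
Qed.

Lemma is_derive_mulmx m p q (f : V -> 'M[R]_(m, p)) (g : V -> 'M[R]_(p, q))
    df dg x v : is_derive x v f df -> is_derive x v g dg ->
  is_derive x v (fun y => f y *m g y) (df *m g x + f x *m dg).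
Proof.
move=> /is_derive_mx hf /is_derive_mx hg; apply/is_derive_mx => i j.
rewrite (_ : (fun y => _) = \sum_k (fun y => f y i k) * (fun y => g y k j)).
  rewrite (_ : (df *m g x + f x *m dg) i j =
    \sum_k (f x i k *: dg k j + g x k j *: df i k)).
    by apply: is_derive_sum => k; exact: is_deriveM.
  rewrite !mxE -big_split/=; apply: eq_bigr => k _.
  by rewrite /GRing.scale/= addrC [g x k j * _]mulrC.
by apply/funext => y; rewrite mxE fct_sumE.
Qed.

Lemma differentiable_mulmx m p q (f : V -> 'M[R]_(m, p)) (g : V -> 'M[R]_(p, q))
    x : differentiable f x -> differentiable g x ->
  differentiable (fun y => f y *m g y) x.
Proof.
move=> /differentiable_mxP hf /differentiable_mxP hg.
apply/differentiable_mxP => i j.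
rewrite (_ : (fun y => _) = \sum_k (fun y => f y i k) * (fun y => g y k j)).
  by apply: differentiable_sum => k; exact: differentiableM.
by apply/funext => y; rewrite mxE fct_sumE.
Qed.

Lemma is_derive_trmx m p (f : V -> 'M[R]_(m, p)) df x v :
  is_derive x v f df -> is_derive x v (fun y => (f y)^T) df^T.
Proof.
move=> /is_derive_mx h; apply/is_derive_mx => i j; rewrite mxE.
by rewrite (_ : (fun y => _) = fun y => f y j i) //; apply/funext=> y;
  rewrite mxE.
Qed.

Lemma is_derive_comp (W Z : normedModType R) (f : V -> W) (g : W -> Z) df x v :
  differentiable f x -> differentiable g (f x) -> is_derive x v f df ->
  is_derive x v (g \o f) ('D_df g (f x)).
Proof.
move=> hf hg [_ <-]; have hgf := differentiable_comp hf hg.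
apply: DeriveDef; first exact: diff_derivable.
by rewrite !deriveE// diff_comp.
Qed.

Lemma differentiable_prod (I : Type) (r : seq I) (f : I -> V -> R) x :
  (forall i, differentiable (f i) x) ->
  differentiable (fun y => \prod_(i <- r) f i y) x.
Proof.
move=> h; elim: r => [|i r IH].
  by rewrite (_ : (fun y => _) = cst 1) //; apply/funext => y; rewrite big_nil.
rewrite (_ : (fun y => _) = f i * (fun y => \prod_(i <- r) f i y)).
  exact: differentiableM.
by apply/funext => y; rewrite big_cons.
Qed.

Lemma differentiable_bigsum (W : normedModType R) (I : Type) (r : seq I)
    (f : I -> V -> W) x :
  (forall i, differentiable (f i) x) ->
  differentiable (fun y => \sum_(i <- r) f i y) x.
Proof.
move=> h; elim: r => [|i r IH].
  by rewrite (_ : (fun y => _) = cst 0) //; apply/funext => y; rewrite big_nil.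
rewrite (_ : (fun y => _) = f i + (fun y => \sum_(i <- r) f i y)).
  exact: differentiableD.
by apply/funext => y; rewrite big_cons.
Qed.

Lemma differentiable_det n (f : V -> 'M[R]_n) x :
  differentiable f x -> differentiable (fun y => \det (f y)) x.
Proof.
move=> /differentiable_mxP h.
rewrite /determinant; apply: differentiable_bigsum => s.
rewrite (_ : (fun y => _) = cst ((-1) ^+ s) * (fun y =>
  \prod_i f y i (s i))) //.
apply: differentiableM; first exact: differentiable_cst.
exact: differentiable_prod.
Qed.

(** Cramer's rule: the cofactor formula is differentiable entrywise. It agrees with [invmx] only
    where the determinant is nonzero, since [invmx] returns singular matrices unchanged; hence the
    passage to a neighbourhood. *)
Lemma differentiable_invmx n (f : V -> 'M[R]_n) x :
  f x \in unitmx -> differentiable f x ->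
  differentiable (fun y => invmx (f y)) x.
Proof.
move=> fx df.
have ddet := differentiable_det df.
have dfx0 : \det (f x) != 0 by rewrite -unitfE -unitmxE.
have h : differentiable (fun y => (\det (f y))^-1 *: \adj (f y)) x.
  apply/differentiable_mxP => i j.
  rewrite (_ : (fun y => _) =
    (fun y => (\det (f y))^-1) * (fun y => \adj (f y) i j)); last first.
    by apply/funext => y; rewrite mxE.
  apply: differentiableM.
    exact: (@differentiableV _ _ (fun y => \det (f y))).
  rewrite (_ : (fun y => _) =
     cst ((-1) ^+ (j + i)) * (fun y => \det (row' j (col' i (f y)))));
       last first.
    by apply/funext => y; rewrite mxE.
  apply: differentiableM; first exact: differentiable_cst.
  apply: differentiable_det; apply/differentiable_mxP => k l.
  rewrite (_ : (fun y => _) = fun y => f y (lift j k) (lift i l)); last first.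
    by apply/funext => y; rewrite !mxE.
  by move/differentiable_mxP: df.
have nz : \forall y \near x, \det (f y) != 0.
  exact: cvgr_neq0 (differentiable_continuous ddet) dfx0.
have e : \forall y \near x, (\det (f y))^-1 *: \adj (f y) = invmx (f y).
  by near=> y; rewrite /invmx unitmxE unitfE ifT//; near: y.
exact: near_eq_differentiable e h.
Unshelve. all: by end_near. Qed.

End MatrixCalculus.

(** * Symmetry of second derivatives *)

Section Young.
Context {R : realType} {V : normedModType R}.

(** Differentiability of ['D_u f] is available at the single point [x]. So the mean value theorem is
    applied once, in direction [u], and the remaining increment of ['D_u f] is compared with its
    differential at [x]. *)
Lemma second_difference_near (f : V -> R) (x u v : V) (e : R) :
  (\forall y \near x, differentiable f y) -> differentiable ('D_u f) x ->
  0 < e -> \forall t \near (0 : R)^'+,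
    `|f (x + t *: u + t *: v) - f (x + t *: u) - f (x + t *: v) + f x
      - t ^+ 2 * 'D_v ('D_u f) x| <= e * t ^+ 2.
Proof.
move=> df ddf e0.
set L := 'd ('D_u f) x.
have -> : 'D_v ('D_u f) x = L v by rewrite deriveE.
(* The final error is at most e / K * t * (2|u| + |v|); the summand 1 keeps [K] positive when both
   vectors vanish. *)
set K := 2 * (`|u| + `|v|) + 1.
have K0 : 0 < K by rewrite /K; have := normr_ge0 u; have := normr_ge0 v; lra.
have eK : 0 < e / K by exact: divr_gt0.
have /nbhs_normP[d /= d0 hd] : \forall y \near x, differentiable f y /\
    `|'D_u f y - 'D_u f x - L (y - x)| <= e / K * `|y - x|.
  by apply: filterI => //; exact: differentiable_near.
have hd1 w : `|w| < d -> differentiable f (x + w) /\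
    `|'D_u f (x + w) - 'D_u f x - L w| <= e / K * `|w|.
  move=> wd; have := hd (x + w); rewrite /= opprD addNKr normrN.
  by move=> /(_ wd)[? ]; rewrite [x + w - x]addrC addKr.
near=> t.
have t0 : 0 < t by near: t; exact: nbhs_right_gt.
have td : t * K < d.
  rewrite -ltr_pdivlMr//; near: t; apply: nbhs_right_lt; exact: divr_gt0.
have small r : 0 <= r <= t -> `|r *: u + t *: v| < d /\ `|r *: u| < d.
  move=> /andP[r0 rt].
  have h1 : `|r *: u| <= t * `|u|.
    by rewrite normrZ ger0_norm// ler_wpM2r.
  have h2 : `|t *: v| <= t * `|v| by rewrite normrZ gtr0_norm.
  have := ler_normD (r *: u) (t *: v).
  have p1 : 0 <= t * `|u| by rewrite mulr_ge0// ltW.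
  have p2 : 0 <= t * `|v| by rewrite mulr_ge0// ltW.
  move: td; rewrite /K mulrDr mulr1 mulrCA mulrDr => td h3; split; lra.
pose g (r : R) := f (x + r *: u + t *: v) - f (x + r *: u).
have dline (w : V) (r : R) : differentiable f (x + r *: u + w) ->
   is_derive r (1 : R) (fun r : R =>
     f (x + r *: u + w)) ('D_u f (x + r *: u + w)).
  move=> h.
  have dl : is_diff r (fun r : R => x + r *: u + w) (0 + *:%R^~ u + 0).
    exact: (is_diffD (is_diffD (is_diff_cst _ _) _) (is_diff_cst _ _)).
  have hl : is_derive r (1 : R) (fun r : R => x + r *: u + w) u.
    apply: DeriveDef; first exact: diff_derivable.
    by rewrite deriveE// diff_val !fctE /= add0r addr0 scale1r.
  exact: (@is_derive_comp _ _ _ _ (fun r : R => x + r *: u + w) f u r 1 _ h hl).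
have dg r : 0 <= r <= t -> is_derive r (1 : R) g
   ('D_u f (x + r *: u + t *: v) - 'D_u f (x + r *: u)).
  move=> /small[h1 h2].
  have [a1 _] := hd1 _ h1; have [a2 _] := hd1 _ h2.
  apply: is_deriveB; first by apply: dline; rewrite -addrA.
  have := dline 0 r; rewrite addr0; under eq_fun do rewrite addr0.
  exact.
have [c /andP[c0 ct] gc] : exists2 c, 0 < c < t &
  g t - g 0 = ('D_u f (x + c *: u + t *: v) - 'D_u f (x + c *: u)) * t.
  have [|||c ct gc] := @MVT _ g
   (fun r => 'D_u f (x + r *: u + t *: v) - 'D_u f (x + r *: u)) 0 t => //.
  - by move=> r; rewrite in_itv/= => /andP[r0 rt]; apply: dg; rewrite !ltW.
  - apply: derivable_within_continuous => r; rewrite in_itv/= => rt.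
    by have [] := dg r rt.
  - by exists c; [rewrite in_itv in ct|rewrite gc subr0].
have [|h1 h2] := small c; first by rewrite !ltW.
have [_ a1] := hd1 _ h1; have [_ a2] := hd1 _ h2.
have gE : g t - g 0 =
    f (x + t *: u + t *: v) - f (x + t *: u) - f (x + t *: v) + f x.
  by rewrite /g scale0r addr0; ring.
rewrite -gE gc.
move: a1 a2; rewrite addrA.
set D1 := 'D_u f (_ + _ + _); set D2 := 'D_u f (_ + _); set D0 := 'D_u f x.
rewrite [L (_ + _)]linearD ![L (_ *: _)]linearZ/= => a1 a2.
have a3 : `|D1 - D2 - t * L v| <= e / K * (c * `|u| + t * `|v|) + e / K *
  (c * `|u|).
  have -> : D1 - D2 - t * L v =
     (D1 - D0 - (c *: L u + t *: L v)) - (D2 - D0 - c *: L u).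
    by rewrite /GRing.scale/=; ring.
  apply: le_trans (ler_normB _ _) _; apply: lerD.
    apply: le_trans a1 _; rewrite ler_pM2l//.
    apply: le_trans (ler_normD _ _) _.
    by rewrite !normrZ (gtr0_norm c0) (gtr0_norm t0).
  by apply: le_trans a2 _; rewrite normrZ (gtr0_norm c0).
have -> : (D1 - D2) * t - t ^+ 2 * L v = t * (D1 - D2 - t * L v) by ring.
rewrite normrM (gtr0_norm t0).
have -> : e * t ^+ 2 = t * (e / K * (t * K)).
  rewrite [e / K * _]mulrCA divfK ?gt_eqF//; ring.
rewrite ler_pM2l//; apply: le_trans a3 _.
rewrite -mulrDr ler_pM2l// /K.
have p1 : c * `|u| <= t * `|u| by rewrite ler_wpM2r// ltW.
have p2 : 0 <= t * `|v| by rewrite mulr_ge0// ltW.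
by rewrite mulrDr mulr1 mulrCA mulrDr; lra.
Unshelve. all: by end_near. Qed.

(** The second difference is symmetric in [u] and [v], and each mixed derivative is its limit after
    division by t^2. *)
Lemma derive_comm_scalar (f : V -> R) (x u v : V) :
  (\forall y \near x, differentiable f y) ->
  differentiable ('D_u f) x -> differentiable ('D_v f) x ->
  'D_v ('D_u f) x = 'D_u ('D_v f) x.
Proof.
move=> df du dv; apply/eqP; rewrite -subr_eq0 -normr_le0.
apply/ler_addgt0Pl => e e0; rewrite addr0.
have e2 : 0 < e / 2 by exact: divr_gt0.
have H1 := second_difference_near v df du e2.
have H2 := second_difference_near u df dv e2.
near (0 : R)^'+ => t.
have t0 : 0 < t by near: t; exact: nbhs_right_gt.
have t2 : 0 < t ^+ 2 by exact: exprn_gt0.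
have h1 : `|f (x + t *: u + t *: v) - f (x + t *: u) - f (x + t *: v) + f x
      - t ^+ 2 * 'D_v ('D_u f) x| <= e / 2 * t ^+ 2.
  exact: (near H1 t).
have h2 : `|f (x + t *: v + t *: u) - f (x + t *: v) - f (x + t *: u) + f x
      - t ^+ 2 * 'D_u ('D_v f) x| <= e / 2 * t ^+ 2.
  exact: (near H2 t).
rewrite -(ler_pM2r t2) -{1}(gtr0_norm t2) -normrM.
move: h1 h2; rewrite [x + t *: v + _]addrAC.
set a := 'D_v _ _; set b := 'D_u _ _; set D := f (_ + _ + _).
set D1 := f (x + t *: u); set D2 := f (x + t *: v) => h1 h2.
have -> : (a - b) * t ^+ 2 =
  (D - D2 - D1 + f x - t ^+ 2 * b) - (D - D1 - D2 + f x - t ^+ 2 * a) by ring.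
apply: le_trans (ler_normB _ _) _.
rewrite [leRHS](_ : _ = e / 2 * t ^+ 2 + e / 2 * t ^+ 2);
  first exact: lerD h2 h1.
by rewrite -mulrDl -splitr.
Unshelve. all: by end_near. Qed.

End Young.

Section MatrixCalculus2.
Context {R : realType} {V : normedModType R}.
Implicit Types x v : V.

Lemma differentiable_is_derive (W : normedModType R) (f : V -> W) x v :
  differentiable f x -> is_derive x v f ('D_v f x).
Proof. by move=> h; apply: derivableP; exact: diff_derivable. Qed.

Lemma is_derive_scale m p (f : V -> R) (g : V -> 'M[R]_(m, p)) df dg x v :
  is_derive x v f df -> is_derive x v g dg ->
  is_derive x v (fun y => f y *: g y) (df *: g x + f x *: dg).
Proof.
move=> hf /is_derive_mx hg; apply/is_derive_mx => i j.
rewrite (_ : (fun y => _) = f * (fun y => g y i j)); last first.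
  by apply/funext => y; rewrite mxE.
rewrite (_ : (df *: g x + f x *: dg) i j = f x *: dg i j + g x i j *: df).
  exact: is_deriveM.
by rewrite !mxE /GRing.scale/=; ring.
Qed.

Lemma differentiable_scale m p (f : V -> R) (g : V -> 'M[R]_(m, p)) x :
  differentiable f x -> differentiable g x ->
  differentiable (fun y => f y *: g y) x.
Proof.
move=> hf /differentiable_mxP hg; apply/differentiable_mxP => i j.
rewrite (_ : (fun y => _) = f * (fun y => g y i j)); last first.
  by apply/funext => y; rewrite mxE.
exact: differentiableM.
Qed.

Lemma differentiable_linmx m p q r (L : {linear 'M[R]_(m, p) ->
  'M[R]_(q, r)}) A :
  differentiable L A.
Proof.
rewrite (_ : (L : _ -> _) =
    fun B => \sum_(i < m) \sum_(j < p) B i j *: L (delta_mx i j)); last first.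
  apply/funext => B; rewrite {1}(matrix_sum_delta B) linear_sum.
  by apply: eq_bigr => i _; rewrite linear_sum; apply: eq_bigr => j _;
    rewrite linearZ.
apply: differentiable_bigsum => i; apply: differentiable_bigsum => j.
exact: differentiableZl (differentiable_coord _ i j).
Qed.

Lemma is_derive_linmx m p q r (L : {linear 'M[R]_(m, p) -> 'M[R]_(q, r)})
    (f : V -> 'M[R]_(m, p)) df x v :
  is_derive x v f df -> is_derive x v (fun y => L (f y)) (L df).
Proof.
move=> [hf <-].
rewrite (_ : (fun y => _) = fun y =>
  \sum_ij f y ij.1 ij.2 *: L (delta_mx ij.1 ij.2)).
  rewrite (_ : L _ = \sum_ij ('D_v f x) ij.1 ij.2 *: L (delta_mx ij.1 ij.2)).
    apply/is_derive_mx => i j.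
    have /is_derive_mx hc := derivableP hf.
    rewrite (_ : (fun y => _) = \sum_ij fun y =>
      (L (delta_mx ij.1 ij.2) i j) *: f y ij.1 ij.2); last first.
      apply/funext => y; rewrite summxE fct_sumE; apply: eq_bigr => ij _.
      by rewrite mxE mulrC.
    rewrite summxE (eq_bigr (fun ij => L (delta_mx ij.1 ij.2) i j *:
      ('D_v f x) ij.1 ij.2)); last by move=> ij _; rewrite mxE mulrC.
    elim: (index_enum _) => [|ij s IH].
      by rewrite !big_nil; exact: is_derive_cst.
    by rewrite !big_cons; apply: is_deriveD => //; exact: is_deriveZ.
  rewrite {1}(matrix_sum_delta ('D_v f x)) pair_big/= linear_sum.
  by apply: eq_bigr => ij _; rewrite linearZ.
apply/funext => y; rewrite {1}(matrix_sum_delta (f y)) pair_big/= linear_sum.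
by apply: eq_bigr => ij _; rewrite linearZ.
Qed.

End MatrixCalculus2.

(** * Closure properties of k-fold differentiability on an open set *)

Section Smooth.
Context {R : realType}.

Lemma derive_basis n m p (f : 'rV[R]_n -> 'M[R]_(m, p)) x v :
  differentiable f x ->
  'D_v f x = \sum_a v 0 a *: 'D_(basis_vec a) f x.
Proof.
move=> df; rewrite deriveE// {1}(row_sum_delta v) linear_sum.
by apply: eq_bigr => a _; rewrite linearZ deriveE.
Qed.

Local Notation td := times_differentiable_on.

(** Derivatives are local on an open set, so functions may be changed off [U]. *)
Lemma td_ext n k m p (U : set 'rV[R]_n) (f g : 'rV[R]_n -> 'M[R]_(m, p)) :
  open U -> (forall x, U x -> f x = g x) -> td k U f -> td k U g.
Proof.
move=> oU; elim: k f g => [//|k IH] f g fg [df hf].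
have near_fg x : U x -> \forall y \near x, f y = g y.
  by move=> Ux; apply: filterS (open_nbhs_nbhs (conj oU Ux)) => y /fg.
split=> [x Ux|a]; first exact: near_eq_differentiable (near_fg x Ux) (df x Ux).
apply: IH (hf a) => x Ux; exact: near_eq_derive (near_fg x Ux).
Qed.

Lemma td_pred n k m p (U : set 'rV[R]_n) (f : 'rV[R]_n -> 'M[R]_(m, p)) :
  td k.+1 U f -> td k U f.
Proof. by elim: k f => [//|k IH] f [df hf]; split => // a; apply: IH. Qed.

Lemma td_cst n k m p (U : set 'rV[R]_n) (A : 'M[R]_(m, p)) : td k U (cst A).
Proof.
elim: k A => [//|k IH] A; split=> [x _|a]; first exact: differentiable_cst.
rewrite (_ : (fun x => _) = cst 0); first exact: IH.
by apply/funext => x; rewrite derive_cst.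
Qed.

Lemma td_add n k m p (U : set 'rV[R]_n) (f g : 'rV[R]_n -> 'M[R]_(m, p)) :
  open U -> td k U f -> td k U g -> td k U (fun x => f x + g x).
Proof.
move=> oU; elim: k f g => [//|k IH] f g [df hf] [dg hg]; split=> [x Ux|a].
  by apply: differentiableD; [exact: df|exact: dg].
apply: td_ext (IH _ _ (hf a) (hg a)) => // x Ux.
by rewrite deriveD//; apply: diff_derivable; [exact: df|exact: dg].
Qed.

Lemma td_sum n k m p (I : Type) (r : seq I) (U : set 'rV[R]_n)
    (f : I -> 'rV[R]_n -> 'M[R]_(m, p)) :
  open U -> (forall i, td k U (f i)) -> td k U (fun x => \sum_(i <- r) f i x).
Proof.
move=> oU hf; elim: r => [|i r IH].
  by under eq_fun do rewrite big_nil; exact: td_cst.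
by under eq_fun do rewrite big_cons; exact: td_add.
Qed.

Lemma td_mulmx n k m p q (U : set 'rV[R]_n) (f : 'rV[R]_n -> 'M[R]_(m, p))
    (g : 'rV[R]_n -> 'M[R]_(p, q)) :
  open U -> td k U f -> td k U g -> td k U (fun x => f x *m g x).
Proof.
move=> oU; elim: k f g => [//|k IH] f g [df hf] [dg hg]; split=> [x Ux|a].
  by apply: differentiable_mulmx; [exact: df|exact: dg].
have hf' : td k U f by apply: td_pred.
have hg' : td k U g by apply: td_pred.
apply: td_ext (td_add oU (IH _ _ (hf a) hg') (IH _ _ hf' (hg a))) => // x Ux.
apply/esym/derive_val/is_derive_mulmx; apply: derivableP; apply: diff_derivable.
  exact: df.
exact: dg.
Qed.

Lemma td_scale n k m p m' p' i j (U : set 'rV[R]_n)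
    (f : 'rV[R]_n -> 'M[R]_(m', p')) (g : 'rV[R]_n -> 'M[R]_(m, p)) :
  open U -> td k U f -> td k U g -> td k U (fun x => f x i j *: g x).
Proof.
move=> oU; elim: k f g => [//|k IH] f g [df hf] [dg hg]; split=> [x Ux|a].
  apply: differentiable_scale; last exact: dg.
  by move/differentiable_mxP: (df x Ux).
have hf' : td k U f by apply: td_pred.
have hg' : td k U g by apply: td_pred.
apply: td_ext (td_add oU (IH _ _ (hf a) hg') (IH _ _ hf' (hg a))) => // x Ux.
apply/esym/derive_val/is_derive_scale; last first.
  by apply: derivableP; apply: diff_derivable; exact: dg.
have /is_derive_mx := differentiable_is_derive (basis_vec a) (df x Ux).
exact.
Qed.

Lemma td_linmx n k m p q r (L : {linear 'M[R]_(m, p) -> 'M[R]_(q, r)})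
    (U : set 'rV[R]_n) (f : 'rV[R]_n -> 'M[R]_(m, p)) :
  open U -> td k U f -> td k U (fun x => L (f x)).
Proof.
move=> oU; elim: k f => [//|k IH] f [df hf]; split=> [x Ux|a].
  exact: (differentiable_comp (df x Ux) (differentiable_linmx L _)).
apply: td_ext (IH _ (hf a)) => // x Ux.
apply/esym/derive_val/is_derive_linmx/derivableP/diff_derivable; exact: df.
Qed.

(** The definition differentiates along basis vectors only; any other direction is a constant
    combination of these. *)
Lemma td_derive n k m p (U : set 'rV[R]_n) (f : 'rV[R]_n -> 'M[R]_(m, p)) v :
  open U -> td k.+1 U f -> td k U ('D_v f).
Proof.
move=> oU [df hf].
apply: (@td_ext _ _ _ _ _ (fun x =>
  \sum_a (cst v x) 0 a *: 'D_(basis_vec a) f x)).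
- by [].
- by move=> x Ux; rewrite derive_basis//; exact: df.
- by apply: td_sum => // a; apply: td_scale (hf a) => //; exact: td_cst.
Qed.

(** By the chain rule a derivative of the composite is a sum of products of derivatives of [s] with
    composites of derivatives of [f]; the induction hypothesis applies to the latter. *)
Lemma td_comp n l k m p (U : set 'rV[R]_n) (W : set 'rV[R]_l)
    (f : 'rV[R]_n -> 'M[R]_(m, p)) (s : 'rV[R]_l -> 'rV[R]_n) :
  open U -> open W -> (forall x, W x -> U (s x)) -> td k U f -> td k W s ->
  td k W (fun x => f (s x)).
Proof.
move=> oU oW sWU; elim: k f => [//|k IH] f [df hf] [ds hs]; split=> [x Wx|a].
  by apply: (differentiable_comp (ds x Wx)); apply: df; exact: sWU.
have hs' : td k W s by apply: td_pred.
apply: (@td_ext _ _ _ _ _ (fun x => \sum_b ('D_(basis_vec a) s x) 0 b *: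
   'D_(basis_vec b) f (s x))) => //.
  move=> x Wx; rewrite -derive_basis; last by apply: df; exact: sWU.
  apply/esym/derive_val/is_derive_comp.
  - exact: ds.
  - by apply: df; exact: sWU.
  - by apply: derivableP; apply: diff_derivable; exact: ds.
apply: td_sum => // b; apply: td_scale (hs a) _ => //.
exact: IH (hf b) hs'.
Qed.

(** Differentiate f f^-1 = 1 and solve for the derivative of the inverse. *)
Lemma is_derive_invmx n m (f : 'rV[R]_n -> 'M[R]_m) (U : set 'rV[R]_n) x v :
  open U -> U x -> (forall y, U y -> f y \in unitmx) -> differentiable f x ->
  is_derive x v (fun y => invmx (f y))
    (- (invmx (f x) *m 'D_v f x *m invmx (f x))).
Proof.
move=> oU Ux uf df; have di := differentiable_invmx (uf _ Ux) df.
have h := differentiable_is_derive v di.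
have h1 := is_derive_mulmx (differentiable_is_derive v df) h.
have h2 : is_derive x v (fun y => f y *m invmx (f y)) 0.
  apply: (@near_eq_is_derive _ _ _ (cst 1%:M)).
  by apply: filterS (open_nbhs_nbhs (conj oU Ux)) => y Uy; rewrite mulmxV ?uf.
have e := etrans (esym (@derive_val _ _ _ _ _ _ _ h1))
  (@derive_val _ _ _ _ _ _ _ h2).
apply: DeriveDef; first exact: diff_derivable.
move/eqP: e; rewrite addrC addr_eq0 => /eqP/(congr1 (mulmx (invmx (f x)))).
by rewrite mulKmx ?uf// mulmxN mulmxA => ->.
Qed.

(** The derivative of the inverse is a product containing the inverse itself, which is [k] times
    differentiable by induction. *)
Lemma td_invmx n k m (U : set 'rV[R]_n) (f : 'rV[R]_n -> 'M[R]_m) :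
  open U -> (forall x, U x -> f x \in unitmx) -> td k U f ->
  td k U (fun x => invmx (f x)).
Proof.
move=> oU uf; elim: k => [//|k IH] [df hf]; split=> [x Ux|a].
  by apply: differentiable_invmx; [exact: uf|exact: df].
have hI : td k U (fun x => invmx (f x)) by apply: IH; apply: td_pred.
apply: (@td_ext _ _ _ _ _ (fun x => -%R (invmx (f x) *m 'D_(basis_vec a) f x
   *m invmx (f x)))) => //.
  by move=> x Ux; rewrite (derive_val (is_derive := is_derive_invmx _ oU Ux uf
    (df x Ux))).
apply: (@td_linmx _ _ _ _ _ _ -%R) => //.
exact: td_mulmx oU (td_mulmx oU hI (hf a)) hI.
Qed.

Lemma td_derive_comm n m p (U : set 'rV[R]_n) (f : 'rV[R]_n ->
  'M[R]_(m, p)) x u v :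
  open U -> td 2 U f -> U x -> 'D_v ('D_u f) x = 'D_u ('D_v f) x.
Proof.
move=> oU hf Ux; have := hf => -[df _].
have [du _] := td_derive u oU hf; have [dv _] := td_derive v oU hf.
have entry (w : 'rV_n) y i j : U y -> ('D_w f y) i j = 'D_w (fun z =>
  f z i j) y.
  by move=> Uy; rewrite derive_mx ?mxE//; apply: diff_derivable; exact: df.
have nU : \forall y \near x, U y by exact: open_nbhs_nbhs.
have entry2 w w' i j : differentiable ('D_w f) x ->
    ('D_w' ('D_w f) x) i j = 'D_w' ('D_w (fun z => f z i j)) x.
  move=> dw; rewrite derive_mx; last exact: diff_derivable.
    rewrite mxE.
  by apply: near_eq_derive; apply: filterS nU => y; exact: entry.
have dent w i j : differentiable ('D_w f) x ->
    differentiable ('D_w (fun z => f z i j)) x.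
  move=> /differentiable_mxP/(_ i j); apply: near_eq_differentiable.
  by apply: filterS nU => y; exact: entry.
apply/matrixP => i j.
apply: etrans (entry2 u v i j (du x Ux)) _.
apply: etrans _ (esym (entry2 v u i j (dv x Ux))).
apply: derive_comm_scalar (dent u i j (du x Ux)) (dent v i j (dv x Ux)).
by apply: filterS nU => y /df /differentiable_mxP.
Qed.

End Smooth.

(** * The Levi-Civita connection and its curvature *)

Section InnerProduct.
Context {R : realType} {n : nat}.
Implicit Types (b : 'M[R]_n) (u v w : 'rV[R]_n).

Lemma ipDl b u v w : ip b (u + v) w = ip b u w + ip b v w.
Proof. by rewrite /ip !mulmxDl mxE. Qed.
Lemma ipDr b u v w : ip b u (v + w) = ip b u v + ip b u w.
Proof. by rewrite /ip linearD mulmxDr mxE. Qed.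
Lemma ipZl b a u w : ip b (a *: u) w = a * ip b u w.
Proof. by rewrite /ip -!scalemxAl mxE. Qed.
Lemma ipZr b a u w : ip b u (a *: w) = a * ip b u w.
Proof. by rewrite /ip linearZ -scalemxAr mxE. Qed.
Lemma ipNl b u w : ip b (- u) w = - ip b u w.
Proof. by rewrite -scaleN1r ipZl mulN1r. Qed.
Lemma ipNr b u w : ip b u (- w) = - ip b u w.
Proof. by rewrite -scaleN1r ipZr mulN1r. Qed.
Lemma ipBl b u v w : ip b (u - v) w = ip b u w - ip b v w.
Proof. by rewrite ipDl ipNl. Qed.
Lemma ipBr b u v w : ip b u (v - w) = ip b u v - ip b u w.
Proof. by rewrite ipDr ipNr. Qed.
Lemma ip0l b w : ip b 0 w = 0.
Proof. by rewrite /ip !mul0mx mxE. Qed.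
Lemma ip0r b u : ip b u 0 = 0.
Proof. by rewrite /ip linear0 mulmx0 mxE. Qed.

Lemma ip_sym b u v : b^T = b -> ip b u v = ip b v u.
Proof.
move=> bT; rewrite /ip.
have -> : u *m b *m v^T = (v *m b *m u^T)^T by rewrite !trmx_mul trmxK bT
  mulmxA.
by rewrite mxE.
Qed.

Lemma ip_sum_basis b u v : ip b u v = \sum_l ip b u (basis_vec l) * v 0 l.
Proof.
rewrite /ip {1}(row_sum_delta v) linear_sum mulmx_sumr summxE.
by apply: eq_bigr => l _; rewrite linearZ -scalemxAr mxE mulrC.
Qed.

Lemma ip_basisr b u l : ip b u (basis_vec l) = (u *m b) 0 l.
Proof. by rewrite /ip trmx_delta -colE mxE. Qed.

Lemma ip_unit_inj b u v : b \in unitmx -> (forall w, ip b u w = ip b v w) ->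
  u = v.
Proof.
move=> ub h; rewrite -[u](mulmxK ub) -[v](mulmxK ub); congr (_ *m _).
by apply/rowP => l; rewrite -!ip_basisr.
Qed.

Lemma pos_unitmx b : (forall v, v != 0 -> 0 < ip b v v) -> b \in unitmx.
Proof.
move=> pos; rewrite -row_free_unit -kermx_eq0; apply/eqP/row_matrixP => k.
rewrite row0; apply/eqP/negbNE/negP => /pos; rewrite /ip.
have -> : row k (kermx b) *m b = 0 by rewrite -row_mul mulmx_ker row0.
by rewrite mul0mx mxE ltxx.
Qed.

End InnerProduct.

(* Directional derivatives and Christoffel symbols are sealed: unification would
   otherwise unfold [derive] down to limits of filters. *)
Fact der_key : unit. Proof. by []. Qed.

Definition der {R : realType} {V W : normedModType R} : V -> (V -> W) -> V ->
  W :=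
  locked_with der_key (fun v f x => 'D_v f x).

Definition chr {R : realType} {n : nat} :
    ('rV[R]_n -> 'M[R]_n) -> 'rV[R]_n -> 'rV[R]_n -> 'rV[R]_n -> 'rV[R]_n :=
  locked_with der_key (@christoffel R n).

Definition riem {R : realType} {n : nat} : ('rV[R]_n -> 'M[R]_n) ->
    'rV[R]_n -> 'rV[R]_n -> 'rV[R]_n -> 'rV[R]_n -> 'rV[R]_n :=
  locked_with der_key (@curvature R n).

Lemma derE {R : realType} {V W : normedModType R} (v : V) (f : V -> W) x :
  der v f x = 'D_v f x.
Proof. by rewrite /der locked_withE. Qed.

Lemma chrE {R : realType} {n : nat} (g : 'rV[R]_n -> 'M[R]_n) x u v :
  chr g x u v = christoffel g x u v.
Proof. by rewrite /chr locked_withE. Qed.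

Lemma is_derive_bigsum (R : realType) (V W : normedModType R) (I : Type)
    (r : seq I) (f : I -> V -> W) (df : I -> W) x v :
  (forall i, is_derive x v (f i) (df i)) ->
  is_derive x v (fun y => \sum_(i <- r) f i y) (\sum_(i <- r) df i).
Proof.
move=> h; elim: r => [|i r IH].
  under eq_fun do rewrite big_nil.
  by rewrite big_nil; exact: is_derive_cst.
under eq_fun do rewrite big_cons.
by rewrite big_cons; exact: is_deriveD.
Qed.

Lemma riemE {R : realType} {n : nat} (g : 'rV[R]_n -> 'M[R]_n) x u v w :
  riem g x u v w = curvature g x u v w.
Proof. by rewrite /riem locked_withE. Qed.

Section Der.
Context {R : realType} {V W : normedModType R}.
Implicit Types (f : V -> W) (x v : V).

Lemma is_derive_der f x v : differentiable f x -> is_derive x v f (der v f x).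
Proof. by rewrite derE; exact: differentiable_is_derive. Qed.

Lemma der_val f x v df : is_derive x v f df -> der v f x = df.
Proof. by rewrite derE => h; exact: derive_val. Qed.

Lemma near_der f f' x v : (\forall y \near x, f y = f' y) ->
  der v f x = der v f' x.
Proof. by rewrite !derE; exact: near_eq_derive. Qed.

Lemma der_linear f x : differentiable f x -> linear (fun v => der v f x).
Proof. by move=> df a u v; rewrite !derE !deriveE// linearP. Qed.

Lemma der_cst (c : W) x v : der v (fun=> c) x = 0.
Proof. by rewrite derE derive_cst. Qed.

End Der.

Section DerRow.
Context {R : realType} {n : nat}.
Local Notation td := times_differentiable_on.

Lemma der_basis m p (f : 'rV[R]_n -> 'M[R]_(m, p)) x v : differentiable f x ->
  der v f x = \sum_a v 0 a *: der (basis_vec a) f x.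
Proof.
by move=> df; rewrite derE derive_basis//; apply: eq_bigr => a _; rewrite derE.
Qed.

Lemma td_der k m p (U : set 'rV[R]_n) (f : 'rV[R]_n -> 'M[R]_(m, p)) v :
  open U -> td k.+1 U f -> td k U (der v f).
Proof.
move=> oU hf; apply: td_ext (td_derive v oU hf) => // x _; exact/esym/derE.
Qed.

Lemma derC m p (U : set 'rV[R]_n) (f : 'rV[R]_n -> 'M[R]_(m, p)) x u v :
  open U -> td 2 U f -> U x -> der v (der u f) x = der u (der v f) x.
Proof.
move=> oU hf Ux; rewrite !derE.
rewrite (_ : der u f = 'D_u f); last by apply/funext => y; exact: derE.
rewrite (_ : der v f = 'D_v f); last by apply/funext => y; exact: derE.
exact: td_derive_comm Ux.
Qed.

End DerRow.

Section InnerProductDerive.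
Context {R : realType} {n : nat} {V : normedModType R}.

Lemma is_derive_ip (g : V -> 'M[R]_n) (f h : V -> 'rV[R]_n) dg df dh x v :
  is_derive x v g dg -> is_derive x v f df -> is_derive x v h dh ->
  is_derive x v (fun y => ip (g y) (f y) (h y))
    (ip dg (f x) (h x) + ip (g x) df (h x) + ip (g x) (f x) dh).
Proof.
move=> hg hf hh.
have /is_derive_mx/(_ 0 0) :=
  is_derive_mulmx (is_derive_mulmx hf hg) (is_derive_trmx hh).
rewrite (_ : ((_ + _) *m _ + _) 0 0 = ip dg (f x) (h x) + ip (g x) df (h x) +
  ip (g x) (f x) dh) //.
by rewrite mulmxDl mxE [X in X + _ = _]mxE [X in X + _ = _]addrC.
Qed.

End InnerProductDerive.

Section LocalMetric.
Context {R : realType} {n : nat} (U : set 'rV[R]_n) (g : 'rV[R]_n -> 'M[R]_n).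
Hypothesis oU : open U.
Hypothesis g2 : times_differentiable_on 2 U g.
Hypothesis gsym : forall x, U x -> (g x)^T = g x.
Hypothesis gunit : forall x, U x -> g x \in unitmx.
Implicit Types x u v w z : 'rV[R]_n.

Let nearU x : U x -> \forall y \near x, U y.
Proof. by move=> Ux; exact: open_nbhs_nbhs. Qed.

Let dg x : U x -> differentiable g x. Proof. by case: g2 => h _; exact: h. Qed.

Lemma derive_gramDZ x a u v : U x ->
  der (a *: u + v) g x = a *: der u g x + der v g x.
Proof. by move=> Ux; exact: (der_linear (dg Ux)). Qed.

Lemma derive_gram_sym x u : U x -> (der u g x)^T = der u g x.
Proof.
move=> Ux.
have h := is_derive_trmx (is_derive_der u (dg Ux)).
rewrite -(der_val h); apply: near_der.
by apply: filterS (nearU Ux) => y /gsym.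
Qed.

Lemma ip_derive_gramC x u v w : U x -> ip (der u g x) v w = ip (der u g x) w v.
Proof. by move=> Ux; apply: ip_sym; exact: derive_gram_sym. Qed.

(** Koszul's formula for constant fields. With the index lowered no inverse matrix is left;
    identities between vectors are then tested against every [w] by [ip_unit_inj]. *)
Lemma ip_christoffel x u v w : U x ->
  ip (g x) (chr g x u v) w =
  2^-1 * (ip (der u g x) v w + ip (der v g x) u w - ip (der w g x) u v).
Proof.
move=> Ux; rewrite chrE /christoffel -!scalemxAl ipZl; congr (_ * _).
under eq_mx do rewrite -!derE.
rewrite {1}/ip mulmxKV ?gunit// mxE.
rewrite (ip_sum_basis (der u g x) v w) (ip_sum_basis (der v g x) u w).
have -> : ip (der w g x) u v = \sum_l ip (der (basis_vec l) g x) u v * w 0 l.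
  rewrite der_basis; last exact: dg.
  rewrite /ip mulmx_sumr mulmx_suml summxE; apply: eq_bigr => l _.
  by rewrite -scalemxAr -scalemxAl mxE mulrC.
rewrite -big_split -sumrB/=; apply: eq_bigr => l _.
by rewrite !mxE; ring.
Qed.

Lemma christoffelC x u v : U x -> chr g x u v = chr g x v u.
Proof.
move=> Ux; apply: (ip_unit_inj (gunit Ux)) => w; rewrite !ip_christoffel//.
by rewrite [ip _ u v]ip_derive_gramC//; ring.
Qed.

Lemma christoffel_linearr x u : U x -> linear (chr g x u).
Proof.
move=> Ux a v v'; apply: (ip_unit_inj (gunit Ux)) => w.
rewrite ipDl ipZl !ip_christoffel// derive_gramDZ//.
rewrite !(ipDl, ipDr, ipZl, ipZr).
have -> : ip (a *: der v g x + der v' g x) u w =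
  a * ip (der v g x) u w + ip (der v' g x) u w.
  by rewrite /ip mulmxDr mulmxDl -scalemxAr -scalemxAl mxE [in LHS]mxE.
by ring.
Qed.

Lemma christoffelDr x u v w : U x ->
  chr g x u (v + w) = chr g x u v + chr g x u w.
Proof. by move=> Ux; have := christoffel_linearr u Ux 1 v w;
  rewrite !scale1r. Qed.

Lemma christoffel0r x u : U x -> chr g x u 0 = 0.
Proof. 
move=> Ux; have := christoffelDr u 0 0 Ux; rewrite addr0 => /eqP.
by rewrite -subr_eq subrr => /eqP.
Qed.

Lemma christoffelZr x a u v : U x ->
  chr g x u (a *: v) = a *: chr g x u v.
Proof.
move=> Ux; have := christoffel_linearr u Ux a v 0.
by rewrite !addr0 christoffel0r// addr0.
Qed.

Lemma christoffelNr x u v : U x -> chr g x u (- v) = - chr g x u v.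
Proof. by move=> Ux; rewrite -scaleN1r christoffelZr// scaleN1r. Qed.

Lemma christoffelDl x u v w : U x ->
  chr g x (u + v) w = chr g x u w + chr g x v w.
Proof. by move=> Ux; rewrite !(christoffelC _ w Ux) christoffelDr. Qed.

Lemma christoffelZl x a u v : U x ->
  chr g x (a *: u) v = a *: chr g x u v.
Proof. by move=> Ux; rewrite !(christoffelC _ v Ux) christoffelZr. Qed.

Lemma christoffel0l x u : U x -> chr g x 0 u = 0.
Proof. by move=> Ux; rewrite christoffelC// christoffel0r. Qed.

(** Separates the dependence on the point from that on the two vectors, so that the product rule
    applies when all three move. *)
Lemma christoffel_basis x u v : U x -> chr g x u v =
  \sum_a \sum_b (u 0 a * v 0 b) *: chr g x (basis_vec a) (basis_vec b).
Proof.
move=> Ux; have suml (I : Type) (r : seq I) (f : I -> 'rV[R]_n) w :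
    chr g x (\sum_(i <- r) f i) w = \sum_(i <- r) chr g x (f i) w.
  elim/big_rec2: _ => [|i y1 y2 _ IH]; first by rewrite christoffel0l.
  by rewrite christoffelDl// IH.
rewrite {1}(row_sum_delta u) suml; apply: eq_bigr => a _.
rewrite christoffelZl// {1}(row_sum_delta v) christoffelC// suml scaler_sumr.
apply: eq_bigr => b _; rewrite christoffelC// christoffelZr// scalerA.
exact.
Qed.

Lemma metric_compat x u v w : U x -> ip (der u g x) v w =
  ip (g x) (chr g x u v) w + ip (g x) v (chr g x u w).
Proof.
move=> Ux; rewrite [ip _ v (chr _ _ _ _)]ip_sym ?gsym// !ip_christoffel//.
rewrite [ip (der u g x) w v]ip_derive_gramC//; by field.
Qed.

Lemma christoffel_td u v :
  times_differentiable_on 1 U (fun y => chr g y u v).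
Proof.
have D w : times_differentiable_on 1 U (der w g) by exact: td_der.
have C m p (A : 'M[R]_(m, p)) := td_cst 1 U A.
(* The row of components becomes a sum of products with constant matrices, a form covered by the
   closure lemmas. *)
apply: (@td_ext _ _ _ _ _ _ (fun y => (2^-1 *: (v *m der u g y + u *m der v g y
  + \sum_l - (u *m der (basis_vec l) g y *m v^T *m basis_vec l)))
  *m invmx (g y))) => //.
  move=> y Uy; rewrite chrE /christoffel -!derE; congr (_ *: _ *m _);
    apply/rowP => l.
  rewrite [LHS]mxE [RHS]mxE -derE [X in X + _]mxE !ip_basisr; congr (_ + _).
  rewrite summxE (bigD1 l)//= big1 ?addr0.
    by rewrite mxE [in LHS]mxE big_ord1 [basis_vec l 0 l]mxE !eqxx mulr1.
  move=> k kl; rewrite mxE [X in - X]mxE big_ord1 [basis_vec k 0 l]mxE.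
  by rewrite [l == k]eq_sym (negPf kl) andbF mulr0 oppr0.
have H1 := td_add oU (td_mulmx oU (C _ _ v) (D u)) (td_mulmx oU (C _ _ u)
  (D v)).
have H2 l : times_differentiable_on 1 U
    (fun y => - (u *m der (basis_vec l) g y *m v^T *m basis_vec l)).
  have h := td_mulmx oU (td_mulmx oU (C _ _ u) (D (basis_vec l))) (C _ _ v^T).
  exact: (@td_linmx _ _ _ _ _ _ _ -%R _ _ oU (td_mulmx oU h (C _ _
    (basis_vec l)))).
have H3 := td_add oU H1 (td_sum (index_enum _) oU H2).
have H4 := @td_linmx _ _ _ _ _ _ _ (GRing.scale 2^-1) _ _ oU H3.
exact: td_mulmx oU H4 (td_invmx oU gunit (td_pred g2)).
Qed.

Lemma christoffel_differentiable u v x : U x -> differentiable (fun y =>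
  chr g y u v) x.
Proof. by case: (christoffel_td u v) => h _; exact: h. Qed.

(** Stated along a map [s] to serve twice: for the identity map when the parallelism equation of phi
    is differentiated, and for a parametrized fibre. *)
Lemma is_derive_christoffel l (s X Y : 'rV[R]_l -> 'rV[R]_n)
    (y a : 'rV[R]_l) (dX dY : 'rV[R]_n) :
  differentiable s y -> (\forall t \near y, U (s t)) ->
  is_derive y a X dX -> is_derive y a Y dY ->
  is_derive y a (fun t => chr g (s t) (X t) (Y t))
    (der (der a s y) (fun x => chr g x (X y) (Y y)) (s y)
     + chr g (s y) dX (Y y) + chr g (s y) (X y) dY).
Proof.
move=> ds Us hX hY; have Usy := nbhs_singleton Us.
pose G a b x := chr g x (basis_vec a) (basis_vec b).
have hG c d : is_derive y a (fun t =>
  G c d (s t)) (der (der a s y) (G c d) (s y)).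
  rewrite derE; apply: (is_derive_comp ds (christoffel_differentiable _ _ Usy)).
  exact: is_derive_der.
have /is_derive_mx hXc := hX; have /is_derive_mx hYc := hY.
apply: (@near_eq_is_derive _ _ _ (fun t =>
   \sum_c \sum_d (X t 0 c * Y t 0 d) *: G c d (s t))).
  by apply: filterS Us => z Uz; rewrite -christoffel_basis.
rewrite [chr _ _ dX _]christoffel_basis// [chr _ _ _ dY]christoffel_basis//.
have -> : der (der a s y) (fun x => chr g x (X y) (Y y)) (s y) =
  \sum_c \sum_d (X y 0 c * Y y 0 d) *: der (der a s y) (G c d) (s y).
  rewrite (near_der (f' := fun x =>
    \sum_c \sum_d (X y 0 c * Y y 0 d) *: G c d x)).
    apply: der_val; apply: is_derive_bigsum => c; apply: is_derive_bigsum => d.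
    by apply: is_deriveZ; exact: is_derive_der
      (christoffel_differentiable _ _ Usy).
  by apply: filterS (nearU Usy) => z Uz; rewrite -christoffel_basis.
rewrite -!big_split/=; apply: is_derive_bigsum => c.
rewrite -!big_split/=; apply: is_derive_bigsum => d.
rewrite -addrA addrC -scalerDl.
apply: is_derive_scale (hG c d).
rewrite addrC [dX 0 c * _]mulrC.
by apply: is_deriveM.
Qed.

Lemma riem_christoffel x u v w : U x -> riem g x u v w =
  der u (fun y => chr g y v w) x - der v (fun y => chr g y u w) x
  + chr g x u (chr g x v w) - chr g x v (chr g x u w).
Proof.
move=> Ux; rewrite riemE /curvature /riemann.
have ncst a b : nabla g (cst a) (cst b) = fun y => chr g y a b.
  by apply/funext => y; rewrite /nabla derive_cst add0r chrE.
rewrite (_ : lie_bracket _ _ = cst 0); last first.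
  by apply/funext => y; rewrite /lie_bracket !derive_cst subr0.
rewrite !ncst [chr g x 0 w]christoffel0l// subr0 /nabla -!derE -!chrE.
by apply/rowP => k; rewrite !mxE; ring.
Qed.

Lemma riem_skew12 x u v w : U x -> riem g x u v w = - riem g x v u w.
Proof.
by move=> Ux; rewrite !riem_christoffel//; apply/rowP => k; rewrite !mxE; ring.
Qed.

Lemma riem_bianchi x u v w : U x ->
  riem g x u v w + riem g x v w u + riem g x w u v = 0.
Proof.
move=> Ux; rewrite !riem_christoffel//.
have C a b c : der a (fun y => chr g y b c) x = der a (fun y => chr g y c b) x.
  by apply: near_der; apply: filterS (nearU Ux) => y Uy; exact: christoffelC.
rewrite (C v w u) (C w u v) (C u w v).
rewrite (christoffelC v w Ux) (christoffelC u w Ux) (christoffelC u v Ux).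
by apply/rowP => k; rewrite !mxE; ring.
Qed.

Let der_chr_linear a u x : U x -> linear (fun v => der a (fun y =>
  chr g y u v) x).
Proof.
move=> Ux c v w.
rewrite (near_der (f' := fun y => c *: chr g y u v + chr g y u w)); last first.
  by apply: filterS (nearU Ux) => y Uy; rewrite christoffel_linearr.
apply: der_val; apply: is_deriveD;
  last exact: is_derive_der (christoffel_differentiable _ _ Ux).
by apply: is_deriveZ; exact: is_derive_der (christoffel_differentiable _ _ Ux).
Qed.

Lemma riem_linear1 x v w : U x -> linear (fun u => riem g x u v w).
Proof.
move=> Ux a u u'; rewrite !riem_christoffel//.
rewrite (der_linear (christoffel_differentiable v w Ux)).
have := der_chr_linear v w Ux a u u'.
have C b c d : der b (fun y => chr g y c d) x = der b (fun y => chr g y d c) x.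
  by apply: near_der; apply: filterS (nearU Ux) => y Uy; exact: christoffelC.
rewrite !(C _ w) => ->.
rewrite !(christoffelDl, christoffelDr, christoffelZl, christoffelZr)//.
by apply/rowP => k; rewrite !mxE; ring.
Qed.

(** The lowered symbols are differentiated instead of the symbols; metric compatibility turns the
    correction into products of two symbols, the shape that reappears in the Gauss equation. *)
Lemma ip_riem x u v w z : U x -> ip (g x) (riem g x u v w) z =
  der u (fun y => ip (g y) (chr g y v w) z) x
  - der v (fun y => ip (g y) (chr g y u w) z) x
  - ip (g x) (chr g x v w) (chr g x u z) + ip (g x) (chr g x u w) (chr g x v z).
Proof.
move=> Ux; rewrite riem_christoffel//.
have D a b : der a (fun y => ip (g y) (chr g y b w) z) x =
  ip (g x) (der a (fun y => chr g y b w) x) z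
  + ip (g x) (chr g x a (chr g x b w)) z + ip (g x) (chr g x b w) (chr g x a z).
  rewrite (der_val (is_derive_ip (is_derive_der a (dg Ux))
     (is_derive_der a (christoffel_differentiable b w Ux))
       (is_derive_cst z x a))).
  by rewrite metric_compat// ip0r addr0; ring.
by rewrite !D !(ipDl, ipNl); ring.
Qed.

(** By metric compatibility, the part symmetric in [w] and [z] is the commutator of second
    derivatives of g(w, z), which is zero. *)
Lemma riem_skew34 x u v w z : U x ->
  ip (g x) (riem g x u v w) z = - ip (g x) (riem g x u v z) w.
Proof.
move=> Ux; rewrite !ip_riem//.
have gS a b : ip (g x) a b = ip (g x) b a by exact: ip_sym (gsym Ux).
have D a b : der a (fun y => ip (g y) (chr g y b w) z) x +
   der a (fun y => ip (g y) (chr g y b z) w) x = ip (der a (der b g) x) w z.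
  have h c d := is_derive_ip (is_derive_der a (dg Ux))
     (is_derive_der a (christoffel_differentiable b c Ux))
       (is_derive_cst d x a).
  rewrite (der_val (h w z)) (der_val (h z w)).
  rewrite -(der_val (is_deriveD (h w z) (h z w))).
  rewrite (near_der (f' := fun y => ip (der b g y) w z)); last first.
    apply: filterS (nearU Ux) => y Uy; rewrite metric_compat//.
    by rewrite [ip _ w _]ip_sym// gsym.
  have /is_derive_der : differentiable (der b g) x.
    by have [h2 _] := td_der b oU g2; exact: h2.
  move=> h2; rewrite (der_val (is_derive_ip (h2 a) (is_derive_cst w x a)
    (is_derive_cst z x a))).
  by rewrite ip0l ip0r !addr0.
have := D u v; have := D v u; rewrite (derC _ _ oU g2 Ux) => <-.
rewrite [ip _ (chr g x u z) _]gS [ip _ (chr g x v z) _]gS => H.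
lra.
Qed.

End LocalMetric.

(** * Kaehler-like curvature tensors *)

Section CurvatureAlgebra.
Context {R : realType} {V : lmodType R}.
Variable K : V -> V -> V -> V -> R.
Hypothesis Klin1 : forall v w z, scalar (fun u => K u v w z).
Hypothesis K12 : forall u v w z, K u v w z = - K v u w z.
Hypothesis K34 : forall u v w z, K u v w z = - K u v z w.
Hypothesis Kbianchi : forall u v w z, K u v w z + K v w u z + K w u v z = 0.

(** The octahedron argument: combine the Bianchi identities of the four triples with the two skew
    symmetries. It is linear in the values of [K] at permutations of the four vectors. *)
Lemma curvature_pair_sym u v w z : K u v w z = K w z u v.
Proof.
have := Kbianchi u v w z; have := Kbianchi v w z u.
have := Kbianchi w z u v; have := Kbianchi z u v w.
have := K34 u v w z; have := K34 v w u z; have := K34 w u v z.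
have := K34 v w z u; have := K34 w z v u; have := K34 z v w u.
have := K34 w z u v; have := K34 z u w v; have := K34 u w z v.
have := K34 z u v w; have := K34 u v z w; have := K34 v z u w.
have := K12 u v w z; have := K12 v w u z; have := K12 w u v z.
have := K12 v w z u; have := K12 w z v u; have := K12 z v w u.
have := K12 w z u v; have := K12 z u w v; have := K12 u w z v.
have := K12 z u v w; have := K12 u v z w; have := K12 v z u w.
have := K12 u w v z; have := K34 w u z v; have := K34 u w v z.
have := K12 z v u w.
lra.
Qed.

Lemma KDl u u' v w z : K (u + u') v w z = K u v w z + K u' v w z.
Proof. by have := Klin1 v w z 1 u u'; rewrite scale1r mul1r. Qed.

Lemma KNl u v w z : K (- u) v w z = - K u v w z.
Proof.
have := Klin1 v w z (-1) u u; have := KDl u (-u) v w z.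
rewrite addrN scaleN1r addNr mulN1r addNr => H H0; move: H; rewrite H0; lra.
Qed.

Let KD2 u u' v w z : K v (u + u') w z = K v u w z + K v u' w z.
Proof. by rewrite ![K v _ _ _]K12 KDl; lra. Qed.
Let KN2 u v w z : K v (- u) w z = - K v u w z.
Proof. by rewrite ![K v _ _ _]K12 KNl. Qed.
Let KD3 u u' v w z : K v w (u + u') z = K v w u z + K v w u' z.
Proof. by rewrite ![K v w _ z]curvature_pair_sym KDl. Qed.
Let KN3 u v w z : K v w (- u) z = - K v w u z.
Proof. by rewrite ![K v w _ z]curvature_pair_sym KNl. Qed.
Let KD4 u u' v w z : K v w z (u + u') = K v w z u + K v w z u'.
Proof. by rewrite ![K v w z _]curvature_pair_sym KD2. Qed.
Let KN4 u v w z : K v w z (- u) = - K v w z u.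
Proof. by rewrite ![K v w z _]curvature_pair_sym KN2. Qed.

Variables (J : V -> V) (D : V -> Prop).
Hypothesis JD : forall u v, J (u + v) = J u + J v.
Hypothesis JN : forall u, J (- u) = - J u.
Hypothesis DJ : forall u, D u -> D (J u).
Hypothesis JJ : forall u, D u -> J (J u) = - u.
Hypothesis KJ : forall u v w z, D w -> D z -> K u v (J w) (J z) = K u v w z.

(* The sectional curvatures of a Kaehler-like curvature tensor in terms of the
   holomorphic ones (Bishop and Goldberg). *)
Lemma holomorphic_curvature_polarization X Y : D X -> D Y ->
  let Q E := K E (J E) (J E) E in
  32 * K X Y Y X = 3 * Q (X + J Y) + 3 * Q (X - J Y) - Q (X + Y) - Q (X - Y)
                   - 4 * Q X - 4 * Q Y.
Proof.
move=> DX DY /=.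
rewrite !(JD, JN) !JJ// opprK.
set b := J X; set d := J Y.
have Db : D b by exact: DJ.
have Dd : D d by exact: DJ.
have Jb : J b = - X by exact: JJ.
have Jd : J d = - Y by exact: JJ.
have KJ1 u v w z : D u -> D v -> K (J u) (J v) w z = K u v w z.
  by move=> *; rewrite curvature_pair_sym KJ// curvature_pair_sym.
rewrite !(KDl, KNl, KD2, KN2, KD3, KN3, KD4, KN4).
(* With b = J X and d = J Y, invariance under J reduces the mixed terms of degree 2 in each of X and
   Y to K X Y Y X, K X d d X and K X b Y d. *)
have e1 : K d b b d = K X Y Y X.
  by rewrite /d /b KJ1// KJ// K12 K34 opprK.
have e2 : K Y b b Y = K X d d X.
  have := KJ1 Y b b Y DY Db; rewrite Jb -/d KN2 => <-.
  have := @KJ d X b Y Db DY; rewrite Jb -/d KN3 => <-.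
  by rewrite K12 K34 !opprK.
have e3 : K d b Y X = - K X Y Y X by rewrite /d /b KJ1// K12.
have e4 : K X Y b d = - K X Y Y X by rewrite /d /b KJ// K34.
have e5 : K Y b d X = K X d d X.
  by have := KJ1 Y b d X DY Db; rewrite Jb -/d KN2 => <-; rewrite K12 opprK.
have e6 : K X d b Y = K X d d X.
  by have := @KJ X d b Y Db DY; rewrite Jb -/d KN3 => <-; rewrite K34 opprK.
have e7 : K X b d Y = - K X b Y d by rewrite K34.
have e8 : K d Y b X = K X b Y d by rewrite curvature_pair_sym K12 K34 opprK.
have e9 : K Y d b X = - K X b Y d by rewrite K12 e8.
have e10 : K d Y Y d = K Y d d Y by rewrite K12 K34 opprK.
(* The Bianchi identity expresses K X b Y d by the other two. *)
have := Kbianchi X b Y d; rewrite [K b Y X d]curvature_pair_sym e6 [K Y X b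
  d]K12 e4.
lra.
Qed.

Variables (q : V -> V -> R) (c : R).
Hypothesis qC : forall u v, q u v = q v u.
Hypothesis qD : forall u v w, q (u + v) w = q u w + q v w.
Hypothesis qZ : forall a u w, q (a *: u) w = a * q u w.
Hypothesis qJ : forall u v, D u -> D v -> q (J u) (J v) = q u v.
Hypothesis q_pos : forall u, u != 0 -> 0 < q u u.
Hypothesis JZ : forall a u, J (a *: u) = a *: J u.
Hypothesis DD : forall u v, D u -> D v -> D (u + v).
Hypothesis DZ : forall a u, D u -> D (a *: u).
Hypothesis Kunit : forall E, D E -> q E E = 1 -> K E (J E) (J E) E = c.

Let K0 v w z : K 0 v w z = 0.
Proof. by have := KDl 0 0 v w z; rewrite addr0; lra. Qed.

Let KZ1 a u v w z : K (a *: u) v w z = a * K u v w z.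
Proof. by have := Klin1 v w z a u 0; rewrite !addr0 K0 addr0. Qed.

Let KZ2 a u v w z : K v (a *: u) w z = a * K v u w z.
Proof. by rewrite K12 KZ1 (K12 v) mulrN. Qed.

(** [Kunit] speaks of unit vectors, and both sides are homogeneous of degree 4. The zero vector,
    which cannot be normalized, is treated apart. *)
Let holomorphic_curvature E : D E -> K E (J E) (J E) E = c * q E E ^+ 2.
Proof.
move=> DE; have [->|E0] := eqVneq E 0.
  have q0 : q 0 0 = 0 by rewrite -(scale0r 0) qZ mul0r.
  by rewrite K0 q0 expr0n mulr0.
have qE := q_pos E0; pose r := Num.sqrt (q E E).
have r0 : r != 0 by rewrite gt_eqF// sqrtr_gt0.
have rr : r * r = q E E by rewrite -expr2 sqr_sqrtr// ltW.
have EE : E = r *: (r^-1 *: E) by rewrite scalerA divff// scale1r.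
have := Kunit (DZ r^-1 DE); rewrite qZ qC qZ -rr.
rewrite (_ : r^-1 * (r^-1 * (r * r)) = 1); last by field.
move=> /(_ erefl) <-.
set F := r^-1 *: E; rewrite EE -/F JZ.
rewrite KZ1 KZ2 curvature_pair_sym KZ1 KZ2 curvature_pair_sym.
by ring.
Qed.

Lemma space_form_curvature X Y : D X -> D Y ->
  K X Y Y X = c / 4 * (q X X * q Y Y - q X Y ^+ 2 + 3 * q X (J Y) ^+ 2).
Proof.
move=> DX DY; have := holomorphic_curvature_polarization DX DY => /=.
have DN u : D u -> D (- u) by move=> /(DZ (-1)); rewrite scaleN1r.
have DJY := DJ DY.
rewrite !holomorphic_curvature//; try by do ?apply: DD => //; exact: DN.
have qN u w : q (- u) w = - q u w by rewrite -scaleN1r qZ mulN1r.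
have qDr u v w : q w (u + v) = q w u + q w v by rewrite qC qD !(qC w).
have qNr u w : q w (- u) = - q w u by rewrite qC qN qC.
rewrite !(qD, qN, qDr, qNr) qJ// (qC Y X) (qC (J Y) X).
lra.
Qed.

End CurvatureAlgebra.

(** * Parallelism of phi *)

Section CosymplecticAlgebra.
Context {R : realType} {V : Type}.
(* In the application A(u, v, w) = g((nabla_u phi) v, w),
   B(u, v) = g(nabla_u xi, v), e = eta, f = phi and x = xi. *)
Variables (A : V -> V -> V -> R) (B : V -> V -> R).
Variables (e : V -> R) (f : V -> V) (x : V).
Hypothesis Askew : forall u v w, A u v w = - A u w v.
Hypothesis Acyc : forall u v w, A u v w + A v w u + A w u v = 0.
Hypothesis AN : forall u v w,
  A (f u) v w - A (f v) u w - A v u (f w) + A u v (f w) = 0.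
Hypothesis Aff : forall u v w, A u v (f (f w)) = - A u v w + e w * A u v x.
Hypothesis Af : forall u v w,
  A u (f v) w - A u v (f w) = B u v * e w + e v * B u w.
Hypothesis Ax : forall u v, A u v x = - B u (f v).
Hypothesis BC : forall u v, B u v = B v u.
Hypothesis ef : forall v, e (f v) = 0.

(** The classical formula for almost contact metric structures: 2 g((nabla_u phi) v, w) is a
    combination of d Phi at (u, v, w) and (u, f v, f w), of the normality tensor at (v, w) paired
    with f u, and of d eta. These vanish by [Acyc], [AN] and [BC]; the other hypotheses are the
    algebraic identities of the structure and their covariant derivatives. *)
Lemma parallel_of_normal_closed u v w : A u v w = 0.
Proof.
have := AN v w (f u); rewrite !Aff !Ax.
have := Af (f v) w u; have := Af (f w) u v.
have := Af u v (f w); rewrite Aff Ax ef.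
have := Acyc u (f v) (f w); have := Acyc u v w.
have := Askew (f w) v (f u); have := Askew w v u.
rewrite (BC (f v) w) (BC (f v) u) (BC (f w) u) (BC (f w) v) mulr0 add0r.
lra.
Qed.

End CosymplecticAlgebra.

(** * Cosymplectic structures on an open set of coordinates *)

Section LocalCosymplectic.
Context {R : realType} {n : nat} (U : set 'rV[R]_n) (g : 'rV[R]_n -> 'M[R]_n).
Variables (phi : 'rV[R]_n -> 'M[R]_n) (xi : 'rV[R]_n -> 'rV[R]_n).
Local Notation td := times_differentiable_on.
Hypothesis oU : open U.
Hypothesis g2 : td 2 U g.
Hypothesis gsym : forall x, U x -> (g x)^T = g x.
Hypothesis gunit : forall x, U x -> g x \in unitmx.
Hypothesis phi2 : td 2 U phi.
Hypothesis xi1 : td 1 U xi.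
Hypothesis phi_phi : forall x v, U x ->
  v *m phi x *m phi x = - v + ip (g x) v (xi x) *: xi x.
Hypothesis xi_phi : forall x, U x -> xi x *m phi x = 0.
Hypothesis phi_skew : forall x v w, U x ->
  ip (g x) (v *m phi x) w = - ip (g x) v (w *m phi x).
Hypothesis deta0 : forall x u v, U x ->
  der u (fun y => ip (g y) v (xi y)) x = der v (fun y => ip (g y) u (xi y)) x.
Hypothesis dPhi0 : forall x u v w, U x ->
  der u (fun y => ip (g y) v (w *m phi y)) x
  + der v (fun y => ip (g y) w (u *m phi y)) x
  + der w (fun y => ip (g y) u (v *m phi y)) x = 0.
Hypothesis nij0 : forall x u v, U x ->
  v *m der (u *m phi x) phi x - u *m der (v *m phi x) phi x
  + u *m der v phi x *m phi x - v *m der u phi x *m phi x = 0.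
Implicit Types x u v w z : 'rV[R]_n.

Let nearU x : U x -> \forall y \near x, U y.
Proof. by move=> Ux; exact: open_nbhs_nbhs. Qed.

Let dg x : U x -> differentiable g x. Proof. by case: g2 => h _; exact: h. Qed.
Let dphi x : U x -> differentiable phi x.
Proof. by case: phi2 => h _; exact: h. Qed.
Let dxi x : U x -> differentiable xi x. Proof. by case: xi1 => h _;
  exact: h. Qed.

(** In coordinates, [P x u v] is (nabla_u phi) v and [Q x u] is nabla_u xi. *)
Let P x u v := v *m der u phi x + chr g x u (v *m phi x) - chr g x u v *m phi x.
Let Q x u := der u xi x + chr g x u (xi x).

Let is_derive_mulphi x u v : U x ->
  is_derive x u (fun y => v *m phi y) (v *m der u phi x).
Proof.
move=> Ux; have := is_derive_mulmx (is_derive_cst v x u) (is_derive_der u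
  (dphi Ux)).
by rewrite mul0mx add0r.
Qed.

Let is_derive_ip_phi x u v w : U x ->
  is_derive x u (fun y => ip (g y) v (w *m phi y))
    (ip (g x) (P x u w) v + ip (g x) (chr g x u v) (w *m phi x)
     - ip (g x) (chr g x u w) (v *m phi x)).
Proof.
move=> Ux; have := is_derive_ip (is_derive_der u (dg Ux))
  (is_derive_cst v x u) (is_derive_mulphi u w Ux).
rewrite (metric_compat oU g2 gsym gunit)// ip0l /P.
have gS a b : ip (g x) a b = ip (g x) b a by exact: ip_sym (gsym Ux).
rewrite (_ : ip _ _ _ + _ + _ + _ = ip (g x)
  (w *m der u phi x + chr g x u (w *m phi x) - chr g x u w *m phi x) v +
  ip (g x) (chr g x u v) (w *m phi x) - ip (g x) (chr g x u w) (v *m phi x)) //.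
rewrite ipBl ipDl (phi_skew (chr _ _ _ _) _ Ux) ![ip _ v _]gS; ring.
Qed.

Let is_derive_ip_xi x u v : U x ->
  is_derive x u (fun y => ip (g y) v (xi y))
    (ip (g x) (chr g x u v) (xi x) + ip (g x) (Q x u) v).
Proof.
move=> Ux; have := is_derive_ip (is_derive_der u (dg Ux))
  (is_derive_cst v x u) (is_derive_der u (dxi Ux)).
rewrite (metric_compat oU g2 gsym gunit)// ip0l addr0 /Q.
have gS a b : ip (g x) a b = ip (g x) b a by exact: ip_sym (gsym Ux).
by rewrite ipDl -addrA ![ip _ v _]gS [X in _ + X]addrC.
Qed.

Lemma parallel_phi x u v : U x ->
  v *m der u phi x = chr g x u v *m phi x - chr g x u (v *m phi x).
Proof.
move=> Ux.
have gS a b : ip (g x) a b = ip (g x) b a by exact: ip_sym (gsym Ux).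
have cC a b := christoffelC oU g2 gsym gunit a b Ux.
suff P0 : P x u v = 0.
  by apply/eqP; rewrite -subr_eq0 -P0 /P; apply/eqP/rowP => k; rewrite !mxE;
    ring.
apply: (ip_unit_inj (gunit Ux)) => w; rewrite ip0l.
pose A u v w := ip (g x) (P x u v) w.
pose B u v := ip (g x) (Q x u) v.
pose e v := ip (g x) v (xi x).
have Askew u' v' w' : A u' v' w' = - A u' w' v'.
  have := der_val (is_derive_ip_phi u' v' w' Ux).
  rewrite (near_der (f' := fun y => - ip (g y) w' (v' *m phi y))); last first.
    apply: filterS (nearU Ux) => y Uy; rewrite -phi_skew// ip_sym//.
    exact: gsym.
  rewrite (der_val (is_deriveN (is_derive_ip_phi u' w' v' Ux))) /A.
  lra.
apply: (@parallel_of_normal_closed _ _ A B e (fun v => v *m phi x) (xi x)) =>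
  {u v w}.
- exact: Askew.
- move=> u v w; have := dPhi0 u v w Ux.
  rewrite !(der_val (is_derive_ip_phi _ _ _ Ux)).
  rewrite -/(A _ _ _) -/(A v u w) -/(A w v u) (Askew u w v) (Askew v u w)
    (Askew w v u).
  by rewrite (cC v u) (cC w u) (cC w v); lra.
(* The connection is torsion free, so the partial derivatives in the Nijenhuis tensor may be
   replaced by covariant ones. *)
- move=> u v w; rewrite /A.
  have e1 a b : ip (g x) (P x a b) (w *m phi x) = - ip (g x)
    (P x a b *m phi x) w.
    by rewrite phi_skew// opprK.
  rewrite !e1 opprK -ipBl -ipDl -ipBl.
  rewrite (_ : _ - _ = 0) ?ip0l// -[RHS](nij0 u v Ux) /P.
  rewrite !(mulmxDl, mulNmx).
  rewrite (cC (v *m phi x) u) (cC (v *m phi x) (u *m phi x)) (cC v u) (cC v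
    (u *m phi x)).
  by apply/rowP => k; rewrite !mxE; ring.
- by move=> u v w; rewrite /A phi_phi// ipDr ipNr ipZr.
(* This is the covariant derivative of phi^2 = -I + eta (x) xi. *)
- move=> u v w.
  have := is_derive_mulmx (is_derive_mulphi u v Ux) (is_derive_der u (dphi Ux)).
  move/(der_val) => E1.
  have := is_deriveD (is_derive_cst (- v) x u)
    (is_derive_scale (is_derive_ip_xi u v Ux) (is_derive_der u (dxi Ux))).
  move/(der_val); rewrite (near_der (f' := fun y => v *m phi y *m phi y));
    last first.
    by apply: filterS (nearU Ux) => y Uy; rewrite phi_phi.
  rewrite E1 add0r => E.
  rewrite /A; have -> : ip (g x) (P x u v) (w *m phi x) = - ip (g x)
    (P x u v *m phi x) w.
    by rewrite phi_skew// opprK.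
  rewrite opprK -ipDl.
  have -> : P x u (v *m phi x) + P x u v *m phi x = B u v *: xi x + e v *: Q x
    u.
    rewrite /P !(mulmxDl, mulNmx) !phi_phi// (christoffelDr g2 gunit)//.
    rewrite (christoffelNr g2 gunit)// (christoffelZr g2 gunit)//.
    have -> : v *m phi x *m der u phi x = ((ip (g x) (chr g x u v)
      (xi x) + B u v) *: xi x
      + e v *: der u xi x) - v *m der u phi x *m phi x.
      by rewrite -E addrC addKr.
    rewrite /Q /e; apply/rowP => k; rewrite !mxE; ring.
  by rewrite ipDl !ipZl (ip_sym (xi x) _ (gsym Ux)).
(* This is the covariant derivative of phi xi = 0. *)
- move=> u v.
  rewrite Askew /A.
  have : der u (fun y => xi y *m phi y) x = 0.
    rewrite (near_der (f' := fun=> 0)) ?der_cst//.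
    by apply: filterS (nearU Ux) => y /xi_phi.
  rewrite (der_val (is_derive_mulmx (is_derive_der u (dxi Ux))
    (is_derive_der u (dphi Ux)))).
  move/eqP; rewrite addrC addr_eq0 => /eqP; rewrite /P => ->.
  rewrite xi_phi// (christoffel0r g2 gunit)// addr0 -opprD -mulmxDl.
  by rewrite -/(Q x u) ipNl /B phi_skew// opprK.
- move=> u v; have := deta0 u v Ux.
  rewrite !(der_val (is_derive_ip_xi _ _ Ux)) (cC v u) /B.
  by move/addrI.
- by move=> v; rewrite /e phi_skew// xi_phi// ip0r oppr0.
Qed.

(** Differentiate the parallelism equation once more and antisymmetrize in the two directions: the
    second derivatives of phi cancel, and the commutator of curvature and phi is left. *)
Lemma riem_phi x u v w : U x ->
  riem g x u v (w *m phi x) = riem g x u v w *m phi x.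
Proof.
move=> Ux.
have E a b : w *m der a (der b phi) x =
    der a (fun y => chr g y b w) x *m phi x + chr g x b w *m der a phi x
    - (der a (fun y => chr g y b (w *m phi x)) x
       + chr g x b (w *m der a phi x)).
  have [ddphi _] := td_der b oU phi2.
  have := is_derive_mulmx (is_derive_cst w x a) (is_derive_der a (ddphi x Ux)).
  move/der_val; rewrite mul0mx add0r => <-.
  rewrite (near_der (f' := fun y =>
    chr g y b w *m phi y - chr g y b (w *m phi y))); last first.
    by apply: filterS (nearU Ux) => y Uy; rewrite parallel_phi.
  have hid : differentiable (fun y : 'rV[R]_n => y) x by [].
  have h1 := is_derive_christoffel oU g2 gsym gunit hid (nearU Ux)
    (is_derive_cst b x a) (is_derive_mulphi a w Ux).
  have h2 := is_derive_mulmx (is_derive_der a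
    (christoffel_differentiable oU g2 gunit b w Ux)) (is_derive_der a
      (dphi Ux)).
  rewrite (der_val (is_deriveB h2 h1)) (christoffel0l oU g2 gsym gunit)// addr0.
  by rewrite (der_val (is_derive_id x a)).
have := E u v; rewrite (derC v u oU phi2 Ux) E !parallel_phi//.
rewrite !(riem_christoffel oU g2 gsym gunit)//.
rewrite !(christoffelDr g2 gunit)// !(christoffelNr g2 gunit)//.
rewrite !(mulmxDl, mulNmx) => /eqP; rewrite -subr_eq0 => /eqP H.
apply/eqP; rewrite -subr_eq0; apply/eqP; rewrite -[RHS]H.
by apply/rowP => k; rewrite !mxE; ring.
Qed.

End LocalCosymplectic.

(** * The Gauss equation along an immersion *)

Lemma delta11 (R : realType) : delta_mx 0 0 = 1%:M :> 'M[R]_1.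
Proof. by apply/matrixP => i j; rewrite !mxE !ord1. Qed.

Lemma jacobian_td (R : realType) k l m (U : set 'rV[R]_l) (f : 'rV[R]_l ->
  'rV[R]_m) :
  open U -> times_differentiable_on k.+1 U f ->
  times_differentiable_on k U (jacobian f).
Proof.
move=> oU hf.
apply: (@td_ext _ _ _ _ _ _
   (fun y => \sum_a (delta_mx a 0 : 'cV_l) *m der (basis_vec a) f y)) => //.
  move=> y Uy; have df : differentiable f y by case: hf => h _; exact: h.
  apply/row_matrixP => a; rewrite !rowE -deriveEjacobian// -derE.
  rewrite mulmx_sumr (bigD1 a)//= big1 ?addr0 => [|b ba].
    by rewrite mulmxA mul_delta_mx delta11 mul1mx.
  by rewrite mulmxA mul_delta_mx_0 ?mul0mx// eq_sym.
by apply: (td_sum (index_enum _) oU) => a;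
  exact: td_mulmx oU (td_cst _ _ _) (td_der _ oU hf).
Qed.

Section Gauss.
Context {R : realType} {n l : nat} (U : set 'rV[R]_n) (g : 'rV[R]_n -> 'M[R]_n).
Local Notation td := times_differentiable_on.
Hypothesis oU : open U.
Hypothesis g2 : td 2 U g.
Hypothesis gsym : forall x, U x -> (g x)^T = g x.
Hypothesis gunit : forall x, U x -> g x \in unitmx.
Variables (W : set 'rV[R]_l) (s : 'rV[R]_l -> 'rV[R]_n).
Hypothesis oW : open W.
Hypothesis s3 : td 3 W s.
Hypothesis sWU : forall y, W y -> U (s y).
Implicit Types (y a b c d : 'rV[R]_l).

Let nearW y : W y -> \forall t \near y, W t.
Proof. by move=> Wy; exact: open_nbhs_nbhs. Qed.

Let nearsU y : W y -> \forall t \near y, U (s t).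
Proof. by move=> Wy; apply: filterS (nearW Wy) => t; exact: sWU. Qed.

Let ds y : W y -> differentiable s y. Proof. by case: s3 => h _; exact: h. Qed.

Let dds b y : W y -> differentiable (der b s) y.
Proof. by case: (td_der b oW s3) => h _; exact: h. Qed.

Let ddds b c y : W y -> differentiable (der b (der c s)) y.
Proof. by case: (td_der b oW (td_der c oW s3)) => h _; exact: h. Qed.

Definition pullback_metric : 'rV[R]_l -> 'M[R]_l := locked_with der_key
  (fun y => jacobian s y *m g (s y) *m (jacobian s y)^T).

Lemma pullback_metricE y :
  pullback_metric y = jacobian s y *m g (s y) *m (jacobian s y)^T.
Proof. by rewrite /pullback_metric locked_withE. Qed.

(** The covariant derivative along [s], in direction [a], of the velocity field of [s] in direction
    [b]. *)
Definition cov_velocity : 'rV[R]_l -> 'rV[R]_l -> 'rV[R]_l -> 'rV[R]_n :=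
  locked_with der_key (fun a b y =>
    der a (der b s) y + chr g (s y) (der a s y) (der b s y)).

Lemma cov_velocityE a b y : cov_velocity a b y =
  der a (der b s) y + chr g (s y) (der a s y) (der b s y).
Proof. by rewrite /cov_velocity locked_withE. Qed.

Local Notation gh := pullback_metric.
Local Notation N := cov_velocity.

Lemma der_jacobian y a : W y -> der a s y = a *m jacobian s y.
Proof. by move=> Wy; rewrite derE deriveEjacobian//; exact: ds. Qed.

Lemma ip_pullback y a b : W y ->
  ip (gh y) a b = ip (g (s y)) (der a s y) (der b s y).
Proof. by move=> Wy; rewrite !der_jacobian// pullback_metricE /ip trmx_mul
  !mulmxA. Qed.

Lemma pullback_metric_td : td 2 W gh.
Proof.
have hJ : td 2 W (jacobian s) := jacobian_td oW s3.
have hg : td 2 W (fun y => g (s y)) := td_comp oU oW sWU g2 (td_pred s3).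
apply: td_ext oW _ (td_mulmx oW (td_mulmx oW hJ hg)
  (@td_linmx _ _ _ _ _ _ _ trmx _ _ oW hJ)).
by move=> y _; rewrite pullback_metricE.
Qed.

Lemma pullback_metric_sym y : W y -> (gh y)^T = gh y.
Proof. by move=> Wy; rewrite !pullback_metricE !trmx_mul trmxK gsym ?mulmxA//;
  exact: sWU. Qed.

Hypothesis ghunit : forall y, W y -> gh y \in unitmx.

Lemma cov_velocityC a b y : W y -> N a b y = N b a y.
Proof.
move=> Wy; rewrite !cov_velocityE (derC a b oW (td_pred s3) Wy).
by rewrite (christoffelC oU g2 gsym gunit)//; exact: sWU.
Qed.

Lemma is_derive_ip_velocity a (X Y : 'rV[R]_l -> 'rV[R]_n) dX dY y : W y ->
  is_derive y a X dX -> is_derive y a Y dY ->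
  is_derive y a (fun t => ip (g (s t)) (X t) (Y t))
    (ip (g (s y)) (dX + chr g (s y) (der a s y) (X y)) (Y y)
     + ip (g (s y)) (X y) (dY + chr g (s y) (der a s y) (Y y))).
Proof.
move=> Wy hX hY; have Usy := sWU Wy.
have dg : differentiable g (s y) by case: g2 => h _; exact: h.
have hg : is_derive y a (fun t => g (s t)) (der (der a s y) g (s y)).
  rewrite derE; apply: (is_derive_comp (ds Wy) dg).
  exact: is_derive_der (ds Wy).
have := is_derive_ip hg hX hY.
rewrite (metric_compat oU g2 gsym gunit)//.
rewrite (_ : ip _ _ _ + _ + _ + _ = ip (g (s y)) (dX + chr g (s y) (der a s y)
  (X y)) (Y y)
  + ip (g (s y)) (X y) (dY + chr g (s y) (der a s y) (Y y))) //.
by rewrite ipDl ipDr; ring.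
Qed.

Lemma ip_der_pullback a b c y : W y -> ip (der a gh y) b c =
  ip (g (s y)) (N a b y) (der c s y) + ip (g (s y)) (der b s y) (N a c y).
Proof.
move=> Wy.
have dgh : differentiable gh y by case: pullback_metric_td => h _; exact: h.
have := der_val (is_derive_ip (is_derive_der a dgh) (is_derive_cst b y a)
  (is_derive_cst c y a)).
rewrite ip0l ip0r !addr0 => <-.
rewrite (near_der (f' := fun t => ip (g (s t)) (der b s t) (der c s t)));
  last first.
  by apply: filterS (nearW Wy) => t; exact: ip_pullback.
by rewrite !cov_velocityE (der_val (is_derive_ip_velocity Wy (is_derive_der a
  (dds b Wy))
  (is_derive_der a (dds c Wy)))).
Qed.

(** Inserting the derivatives of the induced metric in Koszul's formula leaves the ambient covariant
    derivative: the induced connection is its tangential part. *)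
Lemma ip_pullback_christoffel b c d y : W y ->
  ip (gh y) (chr gh y b c) d = ip (g (s y)) (N b c y) (der d s y).
Proof.
move=> Wy; rewrite (ip_christoffel pullback_metric_td ghunit)//.
rewrite !ip_der_pullback//.
have gS u v : ip (g (s y)) u v = ip (g (s y)) v u by exact: ip_sym (gsym
  (sWU Wy)).
rewrite (cov_velocityC d b Wy) (cov_velocityC d c Wy) (cov_velocityC c b Wy).
rewrite [ip _ (der c s y) (N b d y)]gS; by field.
Qed.

Definition second_fundamental : 'rV[R]_l -> 'rV[R]_l -> 'rV[R]_l -> 'rV[R]_n :=
  locked_with der_key (fun b c y => N b c y - der (chr gh y b c) s y).

Lemma second_fundamentalE b c y :
  second_fundamental b c y = N b c y - der (chr gh y b c) s y.
Proof. by rewrite /second_fundamental locked_withE. Qed.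

Local Notation II := second_fundamental.

Lemma second_fundamental_normal b c d y : W y ->
  ip (g (s y)) (II b c y) (der d s y) = 0.
Proof.
by move=> Wy; rewrite second_fundamentalE ipBl -ip_pullback//
  ip_pullback_christoffel// subrr.
Qed.

Lemma is_derive_cov_velocity a b c y : W y ->
  is_derive y a (N b c) (der a (der b (der c s)) y +
    (der (der a s y) (fun x => chr g x (der b s y) (der c s y)) (s y)
     + chr g (s y) (der a (der b s) y) (der c s y)
     + chr g (s y) (der b s y) (der a (der c s) y))).
Proof.
move=> Wy.
rewrite (_ : N b c = fun t => der b (der c s) t + chr g (s t) (der b s t)
  (der c s t));
  last by apply/funext => t; exact: cov_velocityE.
apply: is_deriveD; first exact: is_derive_der (ddds b c Wy).
apply: (is_derive_christoffel oU g2 gsym gunit (ds Wy) (nearsU Wy)).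
  exact: is_derive_der (dds b Wy).
exact: is_derive_der (dds c Wy).
Qed.

(** Covariant derivatives along [s] commute up to the ambient curvature; the third derivatives of
    [s] cancel by symmetry. *)
Lemma cov_velocity_riem a b c y : W y ->
  der a (N b c) y + chr g (s y) (der a s y) (N b c y)
  - (der b (N a c) y + chr g (s y) (der b s y) (N a c y))
  = riem g (s y) (der a s y) (der b s y) (der c s y).
Proof.
move=> Wy; have Usy := sWU Wy.
rewrite !(der_val (is_derive_cov_velocity _ _ _ Wy)).
rewrite (riem_christoffel oU g2 gsym gunit)// !cov_velocityE.
rewrite !(christoffelDr g2 gunit)//.
rewrite (derC b a oW (td_der c oW s3) Wy) (derC b a oW (td_pred s3) Wy).
by apply/rowP => k; rewrite !mxE; ring.
Qed.

Lemma gauss_equation a b c d y : W y ->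
  ip (gh y) (riem gh y a b c) d =
  ip (g (s y)) (riem g (s y) (der a s y) (der b s y) (der c s y)) (der d s y)
  + ip (g (s y)) (II b c y) (II a d y) - ip (g (s y)) (II a c y) (II b d y).
Proof.
move=> Wy.
have Usy := sWU Wy.
rewrite (ip_riem oW pullback_metric_td pullback_metric_sym ghunit)//.
have E a' b' : der a' (fun t => ip (gh t) (chr gh t b' c) d) y =
  ip (g (s y)) (der a' (N b' c) y + chr g (s y) (der a' s y) (N b' c y))
    (der d s y)
  + ip (g (s y)) (N b' c y) (N a' d y).
  rewrite (near_der (f' := fun t => ip (g (s t)) (N b' c t) (der d s t)));
    last first.
    by apply: filterS (nearW Wy) => t; exact: ip_pullback_christoffel.
  have h := is_derive_cov_velocity a' b' c Wy;
    rewrite (der_val h) (cov_velocityE a' d).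
  exact: (der_val (is_derive_ip_velocity Wy h (is_derive_der a' (dds d Wy)))).
rewrite !E -cov_velocity_riem// [in RHS]ipBl.
(* By normality, the product of two values of [II] is that of the full covariant derivatives minus
   that of their tangential parts; the latter are the symbol products of [ip_riem]. *)
have F a' b' c' d' : ip (g (s y)) (II a' b' y) (II c' d' y) =
   ip (g (s y)) (N a' b' y) (N c' d' y) - ip (gh y) (chr gh y a' b')
     (chr gh y c' d').
  have gS u v : ip (g (s y)) u v = ip (g (s y)) v u by exact: ip_sym (gsym Usy).
  rewrite {1}second_fundamentalE ipBl [ip _ (der
    (chr _ _ _ _) _ _) _]gS second_fundamental_normal//.
  rewrite second_fundamentalE ipBr subr0; congr (_ - _).
  rewrite ip_pullback_christoffel//.
rewrite !F; ring.
Qed.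

End Gauss.

(** * The vertical projection and O'Neill's tensor *)

Section VerticalProjection.
Context {R : realType} {n m : nat}.
Implicit Types (G : 'M[R]_n) (J : 'M[R]_(n, m)) (u v w : 'rV[R]_n).

(* The orthogonal projection onto the kernel of [v |-> v *m J], if J is onto. *)
Definition vproj G J : 'M[R]_n :=
  1%:M - J *m invmx (J^T *m invmx G *m J) *m J^T *m invmx G.

Variables (G : 'M[R]_n) (J : 'M[R]_(n, m)).
Hypothesis Gsym : G^T = G.
Hypothesis Gpos : forall v, v != 0 -> 0 < ip G v v.
Hypothesis rJ : \rank J = m.

(** Its quadratic form at w is the squared [G]-length of w J^T G^-1, and J^T is injective on rows
    because [J] has full rank. *)
Lemma gram_pushforward_unit : J^T *m invmx G *m J \in unitmx.
Proof.
have uG := pos_unitmx Gpos.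
apply: pos_unitmx => w w0.
have -> : ip (J^T *m invmx G *m J) w w = ip G (w *m J^T *m invmx G)
  (w *m J^T *m invmx G).
  by rewrite /ip mulmxKV// !trmx_mul trmxK trmx_inv Gsym !mulmxA.
apply: Gpos; apply: contraNneq w0 => /(congr1 (mulmx^~ G)).
rewrite mulmxKV// mul0mx => h.
have fJ : row_free J^T by rewrite /row_free mxrank_tr rJ.
by apply/eqP/(row_free_inj fJ); rewrite h mul0mx.
Qed.

Lemma vproj_vertical v : v *m vproj G J *m J = 0.
Proof.
have u := gram_pushforward_unit.
rewrite /vproj mulmxBr mulmx1 mulmxBl -!mulmxA (mulmxA J^T) mulVmx//.
by rewrite mulmx1 subrr.
Qed.

Lemma vproj_id v : v *m J = 0 -> v *m vproj G J = v.
Proof. by move=> vJ; rewrite /vproj mulmxBr mulmx1 !mulmxA vJ !mul0mx subr0.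
  Qed.

Lemma vproj_idem : vproj G J *m vproj G J = vproj G J.
Proof.
by apply/row_matrixP => k; rewrite row_mul vproj_id// rowE vproj_vertical.
Qed.

Lemma ip_vproj v w : ip G (v *m vproj G J) w = ip G v (w *m vproj G J).
Proof.
have uG := pos_unitmx Gpos.
rewrite /ip trmx_mul !mulmxA; congr ((_ *m _) 0 0); rewrite -!mulmxA;
  congr (_ *m _).
rewrite /vproj mulmxBl mul1mx mulmxKV// linearB/= trmx1 mulmxBr mulmx1.
rewrite !trmx_mul trmxK !trmx_inv Gsym; congr (_ - _).
rewrite !trmx_mul trmxK trmx_inv Gsym !mulmxA mulmxV// mul1mx.
by [].
Qed.

Lemma ip_horizontal v w : w *m J = 0 -> ip G (v *m (1%:M - vproj G J)) w = 0.
Proof.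
by move=> wJ; rewrite mulmxBr mulmx1 ipBl ip_vproj vproj_id// subrr.
Qed.

Let ver := kermx J.
Let hor := kermx (G *m ver^T).

Let disjoint_ver_hor : (ver :&: hor = 0)%MS.
Proof.
apply/eqP/rowV0P => v; rewrite sub_capmx => /andP[/submxP[a va] /sub_kermxP vh].
apply/eqP/negbNE/negP => /Gpos; rewrite /ip {2}va trmx_mul.
by rewrite mulmxA -(mulmxA v) vh mul0mx mxE ltxx.
Qed.

Let vproj_sub v : (v *m vproj G J <= ver)%MS.
Proof. by apply/sub_kermxP; exact: vproj_vertical. Qed.

Let hproj_sub v : (v *m (1%:M - vproj G J) <= hor)%MS.
Proof.
apply/sub_kermxP/rowP => k; rewrite [RHS]mxE.
have rk : row k ver *m J = 0 by rewrite -row_mul mulmx_ker row0.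
rewrite -[RHS](ip_horizontal v rk) /ip tr_row colE !mulmxA -colE.
by rewrite [RHS]mxE.
Qed.

(** The projection built from [kermx] has no visible regularity in [G] and [J]; the closed form has.
    They agree because v = v P + v (1 - P) splits v along the kernel and its orthogonal
    complement. *)
Lemma proj_verE : proj_mx ver hor = vproj G J.
Proof.
apply/row_matrixP => k; rewrite [LHS]rowE [RHS]rowE.
rewrite -{1}[delta_mx 0 k](subrK (delta_mx 0 k *m vproj G J)).
rewrite mulmxDl (proj_mx_id disjoint_ver_hor (vproj_sub _)).
have := hproj_sub (delta_mx 0 k); rewrite mulmxBr mulmx1.
by move/(proj_mx_0 disjoint_ver_hor) => ->; rewrite add0r.
Qed.

Lemma proj_horE : proj_mx hor ver = 1%:M - vproj G J.
Proof.
have dis : (hor :&: ver = 0)%MS by rewrite capmxC.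
apply/row_matrixP => k; rewrite [LHS]rowE [RHS]rowE.
rewrite -{1}[delta_mx 0 k](subrK (delta_mx 0 k *m vproj G J)).
rewrite mulmxDl (proj_mx_0 dis (vproj_sub _)) addr0.
have := hproj_sub (delta_mx 0 k); rewrite mulmxBr mulmx1.
by move/(proj_mx_id dis) => ->.
Qed.

End VerticalProjection.

(** * O'Neill's tensor as the second fundamental form of the fibres *)

Section ONeill.
Context {R : realType} {n m : nat} (U : set 'rV[R]_n) (G : 'rV[R]_n -> 'M[R]_n).
Variable (J : 'rV[R]_n -> 'M[R]_(n, m)).
Local Notation td := times_differentiable_on.
Hypothesis oU : open U.
Hypothesis G2 : td 2 U G.
Hypothesis Gsym : forall x, U x -> (G x)^T = G x.
Hypothesis Gpos : forall x, U x -> forall v, v != 0 -> 0 < ip (G x) v v.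
Hypothesis J1 : td 1 U J.
Hypothesis rJ : forall x, U x -> \rank (J x) = m.
Implicit Types (x u v : 'rV[R]_n).

Local Notation P := (fun y => vproj (G y) (J y)).

Let Gunit x : U x -> G x \in unitmx. Proof. by move=> Ux;
  exact: pos_unitmx (Gpos Ux). Qed.

Lemma vproj_td : td 1 U P.
Proof.
have Jt := @td_linmx _ _ _ _ _ _ _ trmx _ _ oU J1.
have Gi := td_invmx oU Gunit (td_pred G2).
have K := td_invmx oU (fun x Ux =>
  gram_pushforward_unit (Gsym Ux) (Gpos Ux) (rJ Ux))
  (td_mulmx oU (td_mulmx oU Jt Gi) J1).
have H := td_mulmx oU (td_mulmx oU (td_mulmx oU J1 K) Jt) Gi.
exact: td_add oU (td_cst _ _ _) (@td_linmx _ _ _ _ _ _ _ -%R _ _ oU H).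
Qed.

Let dP x : U x -> differentiable P x.
Proof. by case: vproj_td => h _; exact: h. Qed.

(* Agrees with O'Neill's tensor on vertical vectors only. *)
Definition oneill_ver x u v : 'rV[R]_n :=
  (v *m der u P x + chr G x u v) *m (1%:M - P x).

Let nearU x : U x -> \forall y \near x, U y.
Proof. by move=> Ux; exact: open_nbhs_nbhs. Qed.

Let is_derive_vproj x u v : U x ->
  is_derive x u (fun y => v *m P y) (v *m der u P x).
Proof.
move=> Ux; have := is_derive_mulmx (is_derive_cst v x u) (is_derive_der u
  (dP Ux)).
by rewrite mul0mx add0r.
Qed.

(** From the derivative of P P = P: the derivative of the projection sends vertical vectors to
    horizontal ones. *)
Lemma der_vproj_vertical x u v : U x -> v *m J x = 0 ->
  v *m der u P x *m P x = 0.
Proof.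
move=> Ux vJ.
have PP y : U y -> P y *m P y = P y.
  by move=> Uy; exact: vproj_idem (Gsym Uy) (Gpos Uy) (rJ Uy).
have := der_val (is_derive_mulmx (is_derive_vproj u v Ux) (is_derive_der u
  (dP Ux))).
rewrite (near_der (f' := fun y => v *m P y)); last first.
  by apply: filterS (nearU Ux) => y Uy; rewrite -mulmxA PP.
rewrite (der_val (is_derive_vproj u v Ux)) vproj_id// => /eqP.
by rewrite -subr_eq subrr eq_sym => /eqP.
Qed.

(** The projections of the statement are controlled on [U] only. The second summand vanishes: the
    field v HP is zero at x, and its derivative there is minus v times the derivative of P, which is
    horizontal. *)
Lemma oneill_verE (VP HP : 'rV[R]_n -> 'M[R]_n) x u v :
  (forall y, U y -> VP y = P y) -> (forall y, U y -> HP y = 1%:M - P y) ->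
  U x -> u *m J x = 0 -> v *m J x = 0 ->
  nabla G (fun y => u *m VP y) (fun y => v *m VP y) x *m HP x
  + nabla G (fun y => u *m VP y) (fun y =>
    v *m HP y) x *m VP x = oneill_ver x u v.
Proof.
move=> hV hH Ux uJ vJ.
have vH : v *m HP x = 0 by rewrite hH// mulmxBr mulmx1 vproj_id// subrr.
rewrite /nabla vH !hV// hH// (vproj_id _ uJ) (vproj_id _ vJ).
rewrite -!derE -!chrE (christoffel0r G2 Gunit)// addr0.
rewrite (near_der (f' := fun y => v *m P y)); last first.
  by apply: filterS (nearU Ux) => y Uy; rewrite hV.
rewrite (near_der (f := fun y => v *m HP y) (f' := fun y => v - v *m P y));
  last first.
  by apply: filterS (nearU Ux) => y Uy; rewrite hH// mulmxBr mulmx1.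
rewrite (der_val (is_derive_vproj u v Ux)).
rewrite (der_val (is_deriveB (is_derive_cst v x u) (is_derive_vproj u v Ux))).
by rewrite sub0r mulNmx der_vproj_vertical// oppr0 addr0.
Qed.

Lemma oneill_ver_linearr x u : U x -> linear (oneill_ver x u).
Proof.
move=> Ux a v w; rewrite /oneill_ver (christoffel_linearr G2 Gunit)//.
rewrite scalemxAl -mulmxDl; congr (_ *m _).
by rewrite mulmxDl -scalemxAl scalerDr addrACA.
Qed.

Lemma oneill_ver_linearl x v : U x -> linear (fun u => oneill_ver x u v).
Proof.
move=> Ux a u w; rewrite /oneill_ver (der_linear (dP Ux)).
rewrite (christoffelDl oU G2 Gsym Gunit)// (christoffelZl oU G2 Gsym Gunit)//.
rewrite scalemxAl -mulmxDl; congr (_ *m _).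
by rewrite mulmxDr -scalemxAr scalerDr addrACA.
Qed.

Lemma oneill_ver_horizontal x u v w : U x -> w *m J x = 0 ->
  ip (G x) (oneill_ver x u v) w = 0.
Proof.
by move=> Ux; apply: ip_horizontal; [exact: Gsym|exact: Gpos].
Qed.

Section Fibre.
Context {l : nat} (W : set 'rV[R]_l) (s : 'rV[R]_l -> 'rV[R]_n).
Hypothesis oW : open W.
Hypothesis s3 : td 3 W s.
Hypothesis sWU : forall y, W y -> U (s y).
Hypothesis s_tangent : forall y a, W y -> der a s y *m J (s y) = 0.
Hypothesis s_span : forall y v, W y -> v *m J (s y) = 0 ->
  exists a, v = der a s y.
Hypothesis ghunit : forall y, W y -> pullback_metric G s y \in unitmx.
Implicit Types (y a b : 'rV[R]_l).

(** Links the tensor computed from constant extensions in the chart to whichever parametrization of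
    the fibre is given. *)
Lemma oneill_ver_fibre y a b : W y ->
  oneill_ver (s y) (der a s y) (der b s y) = second_fundamental G s a b y.
Proof.
move=> Wy; have Usy := sWU Wy.
have ds : differentiable s y by case: s3 => h _; exact: h.
have dds : differentiable (der b s) y.
  by case: (td_der b oW s3) => h _; exact: h.
have PP := vproj_idem (Gsym Usy) (Gpos Usy) (rJ Usy).
have h1 : is_derive y a (fun t => P (s t)) (der (der a s y) P (s y)).
  rewrite derE; apply: (is_derive_comp ds (dP Usy)); exact: is_derive_der.
(* Velocities along the fibre are vertical; differentiating der b s = (der b s) P trades the
   derivative of P for second derivatives of [s]. *)
have := der_val (is_derive_mulmx (is_derive_der a dds) h1).
rewrite (near_der (f' := der b s)); last first.
  have : \forall t \near y, W t by exact: open_nbhs_nbhs.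
  by apply: filterS => t Wt; rewrite vproj_id// s_tangent.
move/eqP; rewrite addrC -subr_eq => /eqP E.
have PQ : P (s y) *m (1%:M - P (s y)) = 0 by rewrite mulmxBr mulmx1 PP subrr.
have -> : oneill_ver (s y) (der a s y) (der b s y) =
    cov_velocity G s a b y *m (1%:M - P (s y)).
  rewrite /oneill_ver cov_velocityE -E !mulmxDl; congr (_ + _).
  by rewrite mulNmx -mulmxA PQ mulmx0 subr0.
have -> : cov_velocity G s a b y = second_fundamental G s a b y
    + der (chr (pullback_metric G s) y a b) s y.
  by rewrite second_fundamentalE subrK.
rewrite mulmxDl [X in _ + X = _](_ : _ = 0) ?addr0; last first.
  by rewrite mulmxBr mulmx1 vproj_id ?subrr// s_tangent.
(* The vertical part of [II] is tangent to the fibre, hence orthogonal to [II], hence zero. *)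
rewrite mulmxBr mulmx1 [X in _ - X = _](_ : _ = 0) ?subr0//.
apply/eqP/negbNE/negP => /(Gpos Usy).
rewrite ip_vproj; [|exact: Gsym|exact: Gpos]; rewrite -mulmxA PP.
have [c ->] := s_span Wy (vproj_vertical (Gsym Usy) (Gpos Usy) (rJ Usy)
  (second_fundamental G s a b y)).
by rewrite (second_fundamental_normal oU G2 Gsym Gunit oW s3 sWU ghunit)// ltxx.
Qed.

End Fibre.

End ONeill.

(** * Slant fibres of dimension two *)

Lemma row2E (R : realType) (v : 'rV[R]_2) :
  v = v 0 0 *: basis_vec 0 + v 0 1 *: basis_vec 1.
Proof.
rewrite {1}(row_sum_delta v) big_ord_recl big_ord1.
by congr (_ + v 0 _ *: delta_mx 0 _); apply: val_inj.
Qed.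

(* As [(psi u, u) = 0], the hypothesis determines [(psi u, v)] up to sign. *)
Lemma rotation_area (R : realType) (k g11 g12 g22 f a b : R) :
  0 < g11 -> a * g11 + b * g12 = 0 -> f = a * g12 + b * g22 ->
  b * f = k ^+ 2 * g11 -> f ^+ 2 = k ^+ 2 * (g11 * g22 - g12 ^+ 2).
Proof.
move=> g0 h1 h2 h3; apply: (mulIf (lt0r_neq0 g0)).
have h4 : f * g11 = b * (g11 * g22 - g12 ^+ 2).
  have -> : f * g11 = (a * g11) * g12 + b * g22 * g11 by rewrite h2; ring.
  by rewrite (_ : a * g11 = - (b * g12)); [ring|lra].
rewrite expr2 -mulrA h4 (_ : k ^+ 2 * _ * g11 = (k ^+ 2 * g11) *
  (g11 * g22 - g12 ^+ 2)).
  by rewrite -h3; ring.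
by ring.
Qed.

Section SlantFibre.
Context {R : realType} {n m : nat} (U : set 'rV[R]_n) (G : 'rV[R]_n -> 'M[R]_n).
Variables (J : 'rV[R]_n -> 'M[R]_(n, m)) (phi : 'rV[R]_n -> 'M[R]_n) (k : R).
Local Notation td := times_differentiable_on.
Hypothesis oU : open U.
Hypothesis G2 : td 2 U G.
Hypothesis Gsym : forall x, U x -> (G x)^T = G x.
Hypothesis Gpos : forall x, U x -> forall v, v != 0 -> 0 < ip (G x) v v.
Hypothesis rJ : forall x, U x -> \rank (J x) = m.
Hypothesis phi1 : td 1 U phi.
Hypothesis phi_skew : forall x v w, U x ->
  ip (G x) (v *m phi x) w = - ip (G x) v (w *m phi x).
Hypothesis phi_par : forall x u v, U x ->
  v *m der u phi x = chr G x u v *m phi x - chr G x u (v *m phi x).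
Local Notation P := (fun y => vproj (G y) (J y)).
Hypothesis phi_slant : forall x v, U x -> v *m J x = 0 ->
  ip (G x) (v *m phi x *m P x) (v *m phi x *m P x) = k ^+ 2 * ip (G x) v v.
Hypothesis k0 : k != 0.
Variables (W : set 'rV[R]_2) (s : 'rV[R]_2 -> 'rV[R]_n).
Hypothesis oW : open W.
Hypothesis s3 : td 3 W s.
Hypothesis sWU : forall y, W y -> U (s y).
Hypothesis s_tangent : forall y a, W y -> der a s y *m J (s y) = 0.
Hypothesis s_span : forall y v, W y -> v *m J (s y) = 0 ->
  exists a, v = der a s y.
Hypothesis ghpos : forall y, W y -> forall a, a != 0 ->
  0 < ip (pullback_metric G s y) a a.
Implicit Types (y a b : 'rV[R]_2).

Local Notation e0 := (basis_vec 0 : 'rV[R]_2).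
Local Notation e1 := (basis_vec 1 : 'rV[R]_2).
Local Notation gh := (pullback_metric G s).
Local Notation N := (cov_velocity G s).
Local Notation II := (second_fundamental G s).

Let Gunit x : U x -> G x \in unitmx. Proof. by move=> Ux;
  exact: pos_unitmx (Gpos Ux). Qed.
Let ghunit y : W y -> gh y \in unitmx. Proof. by move=> Wy;
  exact: pos_unitmx (ghpos Wy). Qed.

Let ds y : W y -> differentiable s y. Proof. by case: s3 => h _; exact: h. Qed.
Let dds b y : W y -> differentiable (der b s) y.
Proof. by case: (td_der b oW s3) => h _; exact: h. Qed.

Let gS y u v : W y -> ip (G (s y)) u v = ip (G (s y)) v u.
Proof. by move=> Wy; exact: ip_sym (Gsym (sWU Wy)). Qed.

Lemma der2 y a : W y -> der a s y = a 0 0 *: der e0 s y + a 0 1 *: der e1 s y.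
Proof.
move=> Wy; have dl := der_linear (ds Wy).
have d0 : der 0 s y = 0 by have := dl (-1) 0 0;
  rewrite scaler0 addr0 scaleN1r addNr.
rewrite {1}(row2E a) dl; congr (_ + _).
by have := dl (a 0 1) e1 0; rewrite d0 !addr0.
Qed.

Local Notation g11 y := (ip (G (s y)) (der e0 s y) (der e0 s y)).
Local Notation g12 y := (ip (G (s y)) (der e0 s y) (der e1 s y)).
Local Notation g22 y := (ip (G (s y)) (der e1 s y) (der e1 s y)).
Local Notation f y := (ip (G (s y)) (der e0 s y *m phi (s y)) (der e1 s y)).

Lemma e0_neq0 : e0 != 0.
Proof. by apply/eqP => /matrixP/(_ 0 0)/eqP; rewrite !mxE !eqxx oner_eq0. Qed.

Lemma g11_gt0 y : W y -> 0 < g11 y.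
Proof.
by move=> Wy; rewrite -(ip_pullback G s3 _ _ Wy); exact: ghpos e0_neq0.
Qed.

Lemma fibre_area_gt0 y : W y -> 0 < g11 y * g22 y - g12 y ^+ 2.
Proof.
move=> Wy; have g0 := g11_gt0 Wy.
have : 0 < ip (gh y) (- g12 y *: e0 + g11 y *: e1)
  (- g12 y *: e0 + g11 y *: e1).
  apply: ghpos => //; apply/eqP => /matrixP/(_ 0 1); rewrite !mxE/= => /eqP.
  by rewrite mulr0 add0r mulr1 gt_eqF.
rewrite !(ipDl, ipDr, ipZl, ipZr).
have E a b := ip_pullback G s3 a b Wy.
rewrite !E (gS (der e1 s y) (der e0 s y))//.
rewrite [X in 0 < X](_ : _ = g11 y * (g11 y * g22 y - g12 y ^+ 2));
  last by ring.
by rewrite pmulr_rgt0.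
Qed.

Let phi0 x v : U x -> ip (G x) (v *m phi x) v = 0.
Proof. by move=> Ux; have := phi_skew v v Ux;
  rewrite [ip _ v (_ *m _)](ip_sym _ _ (Gsym Ux)); lra. Qed.

(** psi s_1 is tangent to the fibre, orthogonal to s_1 and of length |k| |s_1|, so its product with
    s_2 is, up to sign, k times the area of the parallelogram; squaring removes the sign. *)
Lemma slant_area y : W y ->
  f y ^+ 2 = k ^+ 2 * (g11 y * g22 y - g12 y ^+ 2).
Proof.
move=> Wy; have Usy := sWU Wy.
set v := der e0 s y *m phi (s y).
have ipP w : w *m J (s y) = 0 -> ip (G (s y)) (v *m P (s y)) w = ip (G
  (s y)) v w.
  move=> wJ; rewrite ip_vproj; [|exact: Gsym|exact: Gpos].
  by rewrite vproj_id.
have [c vE] := s_span Wy (vproj_vertical (Gsym Usy) (Gpos Usy) (rJ Usy) v).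
have := phi_slant Usy (s_tangent e0 Wy); rewrite -/v.
have := ipP _ (s_tangent e0 Wy); have := ipP _ (s_tangent e1 Wy).
rewrite vE (der2 c Wy) !(ipDl, ipDr, ipZl, ipZr) [ip _ v (der e0 s y)]phi0//.
rewrite (gS (der e1 s y) (der e0 s y))// => h1 h2 h3.
apply: (rotation_area (g11_gt0 Wy) h2 (esym h1)).
have h4 := congr1 ( *%R (c 0 0)) h2; rewrite mulr0 in h4.
rewrite -h3 -h1; lra.
Qed.

(** In the derivative of the area relation, the tangential parts contribute to each side twice the
    trace of the induced symbol times that side, and so cancel. The normal parts remain, multiplied
    by f. *)
Lemma slant_second_fundamental y a : W y ->
  ip (G (s y)) (II a e0 y) (der e1 s y *m phi (s y)) =
  ip (G (s y)) (II a e1 y) (der e0 s y *m phi (s y)).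
Proof.
move=> Wy; have Usy := sWU Wy.

have dphi : differentiable phi (s y) by case: phi1 => h _; exact: h.
have hphi : is_derive y a (fun t => phi (s t)) (der (der a s y) phi (s y)).
  rewrite derE; apply: (is_derive_comp (ds Wy) dphi);
    exact: is_derive_der (ds Wy).
have hN b : is_derive y a (der b s) (der a (der b s) y).
  exact: is_derive_der (dds b Wy).
have hf : is_derive y a (fun t => f t)
    (ip (G (s y)) (N a e0 y *m phi (s y)) (der e1 s y) +
     ip (G (s y)) (der e0 s y *m phi (s y)) (N a e1 y)).
  have -> : N a e0 y *m phi (s y) = der a (der e0 s) y *m phi (s y)
      + der e0 s y *m der (der a s y) phi (s y)
      + chr G (s y) (der a s y) (der e0 s y *m phi (s y)).
    by rewrite phi_par// cov_velocityE mulmxDl addrA subrK.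
  rewrite cov_velocityE.
  have h := is_derive_ip_velocity oU G2 Gsym Gunit s3 sWU Wy
    (is_derive_mulmx (hN e0) hphi) (hN e1).
  exact: h.
have hg b c : is_derive y a (fun t => ip (G (s t)) (der b s t) (der c s t))
    (ip (G (s y)) (N a b y) (der c s y) + ip (G (s y)) (der b s y) (N a c y)).
  have h := is_derive_ip_velocity oU G2 Gsym Gunit s3 sWU Wy (hN b) (hN c).
  by rewrite !cov_velocityE.
have := der_val (is_deriveM hf hf).
rewrite (near_der (f' := fun t => k ^+ 2 *: (g11 t * g22 t - g12 t * g12 t)));
  last first.
  have : \forall t \near y, W t by exact: open_nbhs_nbhs.
  by apply: filterS => t Wt; rewrite -[LHS]expr2 slant_area// expr2.
rewrite (der_val (is_deriveZ _ (is_deriveB (is_deriveM (hg e0 e0) (hg e1 e1))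
  (is_deriveM (hg e0 e1) (hg e0 e1))))).
have NE b : N a b y = II a b y + der
  (chr gh y a b) s y by rewrite second_fundamentalE subrK.
have f2 := slant_area Wy.
have n0 b c : ip (G (s y)) (II a b y) (der c s y) = 0.
  exact: (second_fundamental_normal oU G2 Gsym Gunit oW s3 sWU ghunit).
have Nip b c : ip (G (s y)) (N a b y) (der c s y) =
    chr gh y a b 0 0 * ip (G (s y)) (der e0 s y) (der c s y)
    + chr gh y a b 0 1 * ip (G (s y)) (der e1 s y) (der c s y).
  by rewrite NE ipDl n0 add0r (der2 (chr gh y a b) Wy) ipDl !ipZl.
have Nip' b c : ip (G (s y)) (der c s y) (N a b y) =
    ip (G (s y)) (N a b y) (der c s y) by exact: gS.
have N0 : ip (G (s y)) (N a e0 y *m phi (s y)) (der e1 s y) =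
    chr gh y a e0 0 0 * f y
    - ip (G (s y)) (II a e0 y) (der e1 s y *m phi (s y)).
  rewrite NE mulmxDl ipDl (der2 (chr gh y a e0) Wy) mulmxDl ipDl -!scalemxAl
    !ipZl.
  by rewrite (phi_skew (II _ _ _) _ Usy) (phi0
    (der e1 s y) Usy) mulr0 addr0 addrC.
have N1 : ip (G (s y)) (der e0 s y *m phi (s y)) (N a e1 y) =
    chr gh y a e1 0 1 * f y
    + ip (G (s y)) (II a e1 y) (der e0 s y *m phi (s y)).
  rewrite NE ipDr (der2 (chr gh y a e1) Wy) ipDr !ipZr (phi0
    (der e0 s y) Usy) mulr0 add0r.
  by rewrite (gS _ (II a e1 y) Wy) addrC.
rewrite N0 N1 !Nip' !Nip (gS (der e1 s y) (der e0 s y) Wy) /GRing.scale/=.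
(* Division by f is possible since k, the cosine of the slant angle in the application, is
   nonzero. *)
have fE : f y != 0.
  rewrite -sqrf_eq0 f2 mulf_eq0 negb_or sqrf_eq0 k0/=.
  by rewrite gt_eqF// fibre_area_gt0.
move: f2; set A := chr gh y a e0 0 0; set B := chr gh y a e0 0 1.
set C := chr gh y a e1 0 0; set D := chr gh y a e1 0 1.
set b0 := ip _ (II a e0 y) _; set b1 := ip _ (II a e1 y) _.
move: fE; set F := f y; set x := g11 y; set z := g12 y;
  set w := g22 y => F0 f2 H.
apply/eqP; rewrite -subr_eq0; apply/eqP/(mulfI F0); rewrite mulr0.
(* [A + D] is the trace of the induced symbol in direction [a]. *)
have h := congr1 ( *%R (A + D)) f2.
lra.
Qed.

End SlantFibre.

(** Dimension count: the rows of [A] lie in the kernel of [J], and both spaces have dimension l. *)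
Lemma kernel_span (R : fieldType) (n m l : nat) (A : 'M[R]_(l,
  n)) (J : 'M[R]_(n, m))
    (v : 'rV[R]_n) : n = (l + m)%N -> \rank A = l -> \rank J = m ->
  A *m J = 0 -> v *m J = 0 -> exists a, v = a *m A.
Proof.
move=> nE rA rJ AJ vJ; apply/submxP.
have sA : (A <= kermx J)%MS by apply/sub_kermxP.
have : (kermx J <= A)%MS.
  by rewrite -(geq_leqif (mxrank_leqif_sup sA)) mxrank_ker rA rJ nE addnK.
by apply: submx_trans; apply/sub_kermxP.
Qed.

(** * Slant bases at a point *)

Section SlantBasis.
Context {R : realType} (G phi : 'M[R]_5) (xi : 'rV[R]_5) (J : 'M[R]_(5, 3)).
Variables (k sn : R).
Hypothesis Gsym : G^T = G.
Hypothesis Gpos : forall v, v != 0 -> 0 < ip G v v.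
Hypothesis rJ : \rank J = 3%N.
Hypothesis phi_skew : forall v w, ip G (v *m phi) w = - ip G v (w *m phi).
Hypothesis phi_phi : forall v, v *m phi *m phi = - v + ip G v xi *: xi.
Hypothesis xi_phi : xi *m phi = 0.
Hypothesis xi_xi : ip G xi xi = 1.
Hypothesis xi_hor : forall v, v *m J = 0 -> ip G v xi = 0.
Local Notation P := (vproj G J).
Hypothesis phi_slant : forall v, v *m J = 0 ->
  ip G (v *m phi *m P) (v *m phi *m P) = k ^+ 2 * ip G v v.
Hypothesis k0 : k != 0.
Hypothesis sn0 : sn != 0.
Hypothesis ksn : k ^+ 2 + sn ^+ 2 = 1.
Implicit Types u v w : 'rV[R]_5.

Let gC u v : ip G u v = ip G v u. Proof. exact: ip_sym. Qed.
Let psi u := u *m phi *m P.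
Let omega u := u *m phi *m (1%:M - P).

Let psi_ver u : psi u *m J = 0.
Proof. exact: (vproj_vertical Gsym Gpos rJ). Qed.

Let psiE u w : w *m J = 0 -> ip G (psi u) w = ip G (u *m phi) w.
Proof. by move=> wJ; rewrite (ip_vproj _ Gsym Gpos) vproj_id. Qed.

Let omegaE u : omega u = u *m phi - psi u.
Proof. by rewrite /omega mulmxBr mulmx1. Qed.

Let omega_hor u w : w *m J = 0 -> ip G (omega u) w = 0.
Proof. by move=> wJ; exact: (ip_horizontal Gsym Gpos _ wJ). Qed.

Let phi0 u : ip G (u *m phi) u = 0.
Proof. have := phi_skew u u; rewrite (gC u); lra. Qed.

Let psi_isom u v : u *m J = 0 -> v *m J = 0 ->
  ip G (psi u) (psi v) = k ^+ 2 * ip G u v.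
Proof.
move=> uJ vJ; have uvJ : (u + v) *m J = 0 by rewrite mulmxDl uJ vJ addr0.
have := phi_slant uvJ; rewrite !mulmxDl -/(psi u) -/(psi v).
rewrite !(ipDl, ipDr) !phi_slant// (gC (psi v)) (gC v u); lra.
Qed.

(** phi is isometric on vectors orthogonal to xi, and psi and omega are its orthogonal components,
    so their scaling factors k^2 and sn^2 add up to 1. *)
Let omega_isom u v : u *m J = 0 -> v *m J = 0 ->
  ip G (omega u) (omega v) = sn ^+ 2 * ip G u v.
Proof.
move=> uJ vJ.
have e : ip G (u *m phi) (v *m phi) = ip G u v.
  by rewrite phi_skew phi_phi ipDr ipNr ipZr (xi_hor uJ) mulr0 addr0 opprK.
have e2 : ip G (u *m phi) (psi v) = k ^+ 2 * ip G u v.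
  by rewrite -psiE// psi_isom.
rewrite omegaE ipBl (gC (psi u)) (omega_hor _ (psi_ver u)) subr0.
by rewrite omegaE ipBr e e2 (_ : sn ^+ 2 = 1 - k ^+ 2); [ring|rewrite -ksn;
  ring].
Qed.

Let omega_xi u : u *m J = 0 -> ip G (omega u) xi = 0.
Proof.
by move=> uJ; rewrite omegaE ipBl phi_skew xi_phi ip0r (xi_hor
  (psi_ver u)) subr0 oppr0.
Qed.

(** Every unit vertical vector generates a slant basis; this supplies the witnesses in the equality
    case. *)
Lemma slant_basis_orthonormal e1 : e1 *m J = 0 -> ip G e1 e1 = 1 ->
  let e2 := k^-1 *: psi e1 in
  forall a b : 'I_5,
    ip G (tnth [tuple e1; e2; sn^-1 *: omega e1; sn^-1 *: omega e2; xi] a)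
         (tnth [tuple e1; e2; sn^-1 *: omega e1; sn^-1 *: omega e2; xi] b)
    = (a == b)%:R.
Proof.
move=> e1J e11 e2.
have e2J : e2 *m J = 0 by rewrite /e2 -scalemxAl psi_ver scaler0.
have e22 : ip G e2 e2 = 1.
  by rewrite /e2 ipZl ipZr psi_isom// e11; field.
have e12 : ip G e1 e2 = 0.
  by rewrite /e2 ipZr (gC e1) psiE// phi0 mulr0.
have e21 : ip G e2 e1 = 0 by rewrite gC.
set e3 := sn^-1 *: omega e1; set e4 := sn^-1 *: omega e2.
have e13 : ip G e1 e3 = 0 by rewrite gC ipZl omega_hor// mulr0.
have e14 : ip G e1 e4 = 0 by rewrite gC ipZl omega_hor// mulr0.
have e23 : ip G e2 e3 = 0 by rewrite gC ipZl omega_hor// mulr0.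
have e24 : ip G e2 e4 = 0 by rewrite gC ipZl omega_hor// mulr0.
have e33 : ip G e3 e3 = 1 by rewrite ipZl ipZr omega_isom// e11; field.
have e34 : ip G e3 e4 = 0 by rewrite ipZl ipZr omega_isom// e12 !mulr0.
have e44 : ip G e4 e4 = 1 by rewrite ipZl ipZr omega_isom// e22; field.
have e15 := xi_hor e1J; have e25 := xi_hor e2J.
have e35 : ip G e3 xi = 0 by rewrite ipZl omega_xi// mulr0.
have e45 : ip G e4 xi = 0 by rewrite ipZl omega_xi// mulr0.
case=> [[|[|[|[|[|//]]]]] pa] [[|[|[|[|[|//]]]]] pb];
  rewrite -val_eqE (tnth_nth 0) (tnth_nth 0) /= ?mulr1n ?mulr0n //;
    by rewrite gC.
Qed.

Variable T : 'rV[R]_5 -> 'rV[R]_5 -> 'rV[R]_5.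
Hypothesis Tl : forall v, linear (fun u => T u v).
Hypothesis Tr : forall u, linear (T u).
Hypothesis T_hor : forall u v w, w *m J = 0 -> ip G (T u v) w = 0.
Hypothesis TC : forall u v, u *m J = 0 -> v *m J = 0 -> T u v = T v u.
Hypothesis T_slant : forall u v w, u *m J = 0 -> v *m J = 0 -> w *m J = 0 ->
  ip G (T u v) (w *m phi) = ip G (T u w) (v *m phi).

Lemma orthonormal_span u1 u2 v : u1 *m J = 0 -> u2 *m J = 0 ->
  ip G u1 u1 = 1 -> ip G u2 u2 = 1 -> ip G u1 u2 = 0 -> v *m J = 0 ->
  exists a b, v = a *: u1 + b *: u2.
Proof.
move=> u1J u2J e11 e22 e12 vJ.
pose A : 'M[R]_(2, 5) := \matrix_(i < 2) (if i == 0 then u1 else u2).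
have AE (c : 'rV[R]_2) : c *m A = c 0 0 *: u1 + c 0 1 *: u2.
  by rewrite {1}(row2E c) mulmxDl -!scalemxAl -!rowE !rowK.
have rA : \rank A = 2%N.
  apply/eqP; rewrite -[_ == _]/(row_free A) -kermx_eq0;
    apply/eqP/row_matrixP => i.
  set c := row i _; have : c *m A = 0 by rewrite -row_mul mulmx_ker row0.
  rewrite AE => h; rewrite row0 (row2E c).
  have := congr1 (fun z => ip G z u1) h; have := congr1 (fun z => ip G z u2) h.
  rewrite !ip0l !ipDl !ipZl e11 e22 e12 (gC u2 u1) e12 !(mulr0, mulr1, addr0,
    add0r).
  by move=> -> ->; rewrite !scale0r addr0.
have AJ : A *m J = 0.
  by apply/row_matrixP => i; rewrite row_mul rowK row0; case: ifP.
have [c ->] := @kernel_span R 5 3 2 A J v erefl rA rJ AJ vJ.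
by exists (c 0 0), (c 0 1); exact: AE.
Qed.

Let TDl u u' v : T (u + u') v = T u v + T u' v.
Proof. by have := Tl v 1 u u'; rewrite !scale1r. Qed.
Let T0l v : T 0 v = 0.
Proof. by have := Tl v (-1) 0 0; rewrite scaler0 addr0 scaleN1r addNr. Qed.
Let TZl a u v : T (a *: u) v = a *: T u v.
Proof. by have := Tl v a u 0; rewrite !addr0 T0l addr0. Qed.
Let TDr u u' v : T v (u + u') = T v u + T v u'.
Proof. by have := Tr v 1 u u'; rewrite !scale1r. Qed.
Let T0r v : T v 0 = 0.
Proof. by have := Tr v (-1) 0 0; rewrite scaler0 addr0 scaleN1r addNr. Qed.
Let TZr a u v : T v (a *: u) = a *: T v u.
Proof. by have := Tr v a u 0; rewrite !addr0 T0r addr0. Qed.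

Lemma vanish_of_orthonormal u1 u2 : u1 *m J = 0 -> u2 *m J = 0 ->
  ip G u1 u1 = 1 -> ip G u2 u2 = 1 -> ip G u1 u2 = 0 ->
  T u1 u1 = 0 -> T u1 u2 = 0 -> T u2 u2 = 0 ->
  forall v w, v *m J = 0 -> w *m J = 0 -> T v w = 0.
Proof.
move=> u1J u2J e11 e22 e12 t11 t12 t22 v w vJ wJ.
have [a [b ->]] := orthonormal_span u1J u2J e11 e22 e12 vJ.
have [a' [b' ->]] := orthonormal_span u1J u2J e11 e22 e12 wJ.
by rewrite !(TDl, TDr, TZl, TZr) (TC u2J u1J) t11 t12 t22 !(scaler0, addr0).
Qed.

Lemma vanish_of_slant_basis e1 : e1 *m J = 0 -> ip G e1 e1 = 1 ->
  let e2 := k^-1 *: psi e1 in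
  let e3 := sn^-1 *: omega e1 in let e4 := sn^-1 *: omega e2 in
  ip G (T e1 e1) e4 = - ip G (T e2 e2) e4 ->
  ip G (T e1 e1) e3 = 0 -> ip G (T e1 e2) e3 = 0 -> ip G (T e2 e2) e3 = 0 ->
  ip G (T e1 e1) xi = 0 -> ip G (T e1 e2) xi = 0 -> ip G (T e2 e2) xi = 0 ->
  forall v w, v *m J = 0 -> w *m J = 0 -> T v w = 0.
Proof.
move=> e1J e11 e2 e3 e4 t4 t113 t123 t223 t115 t125 t225.
have on := slant_basis_orthonormal e1J e11.
have e2J : e2 *m J = 0 by rewrite /e2 -scalemxAl psi_ver scaler0.
have e22 : ip G e2 e2 = 1 by exact: (on (@Ordinal 5 1 isT) (@Ordinal 5 1 isT)).
have e12 : ip G e1 e2 = 0 by exact: (on (@Ordinal 5 0 isT) (@Ordinal 5 1 isT)).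
(* A vector orthogonal to an orthonormal basis vanishes: with the basis as rows of E, the matrix G
   E^T is invertible. *)
have zero v : ip G v e1 = 0 -> ip G v e2 = 0 -> ip G v e3 = 0 ->
  ip G v e4 = 0 ->
    ip G v xi = 0 -> v = 0.
  move=> v1 v2 v3 v4 v5.
  pose E : 'M[R]_5 := \matrix_i tnth [tuple e1; e2; e3; e4; xi] i.
  have EGE : E *m (G *m E^T) = 1%:M.
    apply/matrixP => a b; rewrite [RHS]mxE -(on a b) mxE.
    rewrite /ip -mulmxA mxE; apply: eq_bigr => l _.
    rewrite [E a l]mxE; congr (_ * _).
    rewrite !mxE; apply: eq_bigr => r _; congr (_ * _).
    by rewrite !mxE.
  have [_ uGE] := mulmx1_unit EGE.
  rewrite -[v](mulmxK uGE) [X in X *m _](_ : _ = 0) ?mul0mx//.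
  apply/rowP => b; rewrite [RHS]mxE.
  transitivity (ip G v (tnth [tuple e1; e2; e3; e4; xi] b)).
    rewrite /ip mulmxA !mxE; apply: eq_bigr => r _; congr (_ * _).
    by rewrite !mxE.
  by case: b => [[|[|[|[|[|//]]]]] pb]; rewrite (tnth_nth 0).
(* T is horizontal, so pairing it with omega amounts to pairing it with phi, to which [T_slant]
   applies. *)
have w3 u v : ip G (T u v) e3 = sn^-1 * ip G (T u v) (e1 *m phi).
  by rewrite /e3 ipZr omegaE ipBr (T_hor _ _ (psi_ver _)) subr0.
have w4 u v : ip G (T u v) e4 = sn^-1 * ip G (T u v) (e2 *m phi).
  by rewrite /e4 ipZr omegaE ipBr (T_hor _ _ (psi_ver _)) subr0.
have t114 : ip G (T e1 e1) e4 = 0 by rewrite w4 T_slant// -w3.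
have t124 : ip G (T e1 e2) e4 = 0 by rewrite TC// w4 T_slant// -w3.
(* The remaining component follows from the condition T^4_11 = - T^4_22. *)
have t224 : ip G (T e2 e2) e4 = 0 by rewrite t114 in t4; lra.
apply: (vanish_of_orthonormal e1J e2J e11 e22 e12);
  by apply: zero => //; exact: T_hor.
Qed.

End SlantBasis.

(** * Cosymplectic structures and submersions in charts *)

Section Chart.
Context {R : realType} {n : nat} {M : manifold R n}
  (S : almost_contact_metric M).
Variable i : chart M.
Local Notation G := (gram S i).
Local Notation ph := (Defs.phi S i).
Local Notation x_i := (Defs.xi S i).
Implicit Types u v w : 'rV[R]_n.

Lemma phi_phi_ip x v : img i x ->
  v *m ph x *m ph x = - v + ip (G x) v (x_i x) *: x_i x.
Proof.
move=> ix; rewrite -mulmxA phi_sq// mulmxDr mulmxN mulmx1 mulmxA eta_gram//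
  mulmxA.
by rewrite {1}[v *m _ *m _]mx11_scalar mul_scalar_mx.
Qed.

(** Compose the compatibility g(phi, phi) = g - eta (x) eta with phi and expand phi^2; the eta terms
    vanish as eta o phi = 0. *)
Lemma phi_skew_ip x v w : img i x ->
  ip (G x) (v *m ph x) w = - ip (G x) v (w *m ph x).
Proof.
move=> ix; rewrite /ip trmx_mul !mulmxA -!(mulmxA v).
have Gs := gram_sym S ix.
have e : (x_i x *m G x)^T = Defs.eta S i x by rewrite trmx_mul Gs eta_gram.
have h : ph x *m G x = - (G x *m (ph x)^T).
  have := congr1 (mulmx (ph x)) (phi_gram S ix).
  rewrite !mulmxA phi_sq// mulmxBr mulmxA (eta_phi S ix) mul0mx subr0.
  rewrite mulmxDl mulNmx mul1mx mulmxDl mulNmx => <-.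
  rewrite -[Defs.eta S i x *m x_i x *m G x]mulmxA -[x_i x *m G x]trmxK e
    -mulmxA -trmx_mul.
  by rewrite (eta_phi S ix) trmx0 mulmx0 addr0.
by rewrite h !(mulNmx, mulmxN) mxE.
Qed.

Lemma xi_unit x : img i x -> ip (G x) (x_i x) (x_i x) = 1.
Proof.
by move=> ix; rewrite /ip -mulmxA -eta_gram// eta_xi// mxE eqxx.
Qed.

Lemma smooth_cst (U : set 'rV[R]_n) (v : 'rV[R]_n) : smooth_on U (cst v).
Proof. by move=> k; exact: td_cst. Qed.

Let oU : open (img i). Proof. exact: img_open. Qed.

Let nearU x : img i x -> \forall y \near x, img i y.
Proof. by move=> Ux; exact: open_nbhs_nbhs. Qed.

Let bracket_cst u v : lie_bracket (cst u) (cst v) = cst 0 :> ('rV[R]_n ->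
  'rV[R]_n).
Proof. by apply/funext => y; rewrite /lie_bracket !derive_cst subr0. Qed.

(** This and the next two lemmas test the integrability conditions on constant fields, whose
    brackets vanish, so that only derivatives of the structure tensors are left. *)
Lemma deta_cst : eta_closed S -> forall x u v, img i x ->
  der u (fun y => ip (G y) v (x_i y)) x = der v (fun y => ip (G y) u (x_i y)) x.
Proof.
move=> h x u v ix.
have E a b : der a (fun y => ip (G y) b (x_i y)) x = der a (eta_form S i
  (cst b)) x.
  apply: near_der; apply: filterS (nearU ix) => y iy.
  by rewrite /eta_form eta_gram// mulmxA.
have := h i _ _ (smooth_cst (img i) u) (smooth_cst (img i) v) x ix.
rewrite /ext_deriv1 bracket_cst -!derE !E => /eqP.
rewrite mulf_eq0 invr_eq0 pnatr_eq0/= [eta_form S i (cst 0) x](_ : _ = 0).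
  by rewrite subr0 subr_eq0 => /eqP.
by rewrite /eta_form mul0mx mxE.
Qed.

Lemma dPhi_cst : fundamental_form_closed S -> forall x u v w, img i x ->
  der u (fun y => ip (G y) v (w *m ph y)) x
  + der v (fun y => ip (G y) w (u *m ph y)) x
  + der w (fun y => ip (G y) u (v *m ph y)) x = 0.
Proof.
move=> h x u v w ix.
have := h i _ _ _ (smooth_cst (img i) u) (smooth_cst (img i) v) (smooth_cst
  (img i) w) x ix.
rewrite /ext_deriv2 !bracket_cst -!derE => /eqP.
have Z a : fundamental_form S i (cst 0)
  (cst a) x = 0 by rewrite /fundamental_form ip0l.
rewrite mulf_eq0 invr_eq0 pnatr_eq0/= !Z !subr0 => /eqP.
exact.
Qed.

Lemma nijenhuis_cst : normal_structure S -> eta_closed S ->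
  forall x u v, img i x ->
  v *m der (u *m ph x) ph x - u *m der (v *m ph x) ph x
  + u *m der v ph x *m ph x - v *m der u ph x *m ph x = 0.
Proof.
move=> hn he x u v ix.
have := hn i _ _ (smooth_cst (img i) u) (smooth_cst (img i) v) x ix.
rewrite he//; try exact: smooth_cst.
rewrite mulr0 scale0r addr0 /nijenhuis.
rewrite bracket_cst {1 2}/phi_field !mul0mx add0r.
have dph : differentiable ph x by have [h _] := phi_smooth S i 1; exact: h.
have D a b : 'D_a (phi_field S i (cst b)) x = b *m der a ph x.
  rewrite -derE.
  rewrite (der_val (is_derive_mulmx (is_derive_cst b x a)
    (is_derive_der a dph))).
  by rewrite mul0mx add0r.
have l1 : lie_bracket (phi_field S i (cst u)) (phi_field S i (cst v)) x =
   v *m der (u *m ph x) ph x - u *m der (v *m ph x) ph x.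
  by rewrite /lie_bracket !D.
have l2 : lie_bracket (phi_field S i (cst u)) (cst v) x = - (u *m der v ph x).
  by rewrite /lie_bracket derive_cst sub0r D.
have l3 : lie_bracket (cst u) (phi_field S i (cst v)) x = v *m der u ph x.
  by rewrite /lie_bracket derive_cst subr0 D.
rewrite l1 => <-; rewrite /phi_field l2 l3 mulNmx opprK.
exact.
Qed.

End Chart.

Lemma td_subset (R : realType) n k m p (U V : set 'rV[R]_n)
    (f : 'rV[R]_n -> 'M[R]_(m, p)) : V `<=` U ->
  times_differentiable_on k U f -> times_differentiable_on k V f.
Proof.
move=> VU; elim: k f => [//|k IH] f [df hf]; split=> [x /VU|a]; first exact: df.
exact: IH (hf a).
Qed.

Section SubmersionCharts.
Context {R : realType} {n m : nat} {M : manifold R n} {N : manifold R m}.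
Variables (gM : metric M) (gN : metric N) (F : M ->
  N) (i : chart M) (j : chart N).
Hypothesis hF : riemannian_submersion gM gN F.

Definition sub_dom : set 'rV[R]_n := chart_map i @` (dom i `&` F @^-1` dom j).

Lemma sub_dom_img x : sub_dom x -> img i x.
Proof. by case=> q [iq _] <-; exists q. Qed.

Lemma sub_dom_open : open sub_dom.
Proof.
have [[cF _] _ _] := hF.
have oV : open (dom i `&` F @^-1` dom j).
  apply: openI; first exact: dom_open.
  by move/continuousP: cF; apply; exact: dom_open.
rewrite openE => x [q [iq jq] qx]; rewrite /interior.
have ix : img i x by exists q.
have hV : (dom i `&` F @^-1` dom j) (chart_inv i x) by rewrite -qx chart_mapK.
have n1 : \forall z \near x, (dom i `&` F @^-1` dom j) (chart_inv i z).
  by apply: (chart_inv_continuous ix); exact: open_nbhs_nbhs.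
have n2 : \forall z \near x, img i z by apply: open_nbhs_nbhs; split => //;
  exact: img_open.
near=> z.
have [q' iq' zq'] : img i z by near: z.
exists q' => //.
have : (dom i `&` F @^-1` dom j) (chart_inv i z) by near: z.
by rewrite -zq' chart_mapK.
Unshelve. all: by end_near. Qed.

Lemma chart_rep_td k : times_differentiable_on k sub_dom (chart_rep F i j).
Proof. by have [[_ sF] _ _] := hF; exact: sF. Qed.

Lemma pushforward_td : times_differentiable_on 1 sub_dom
  (Defs.pushforward F i j).
Proof. exact: jacobian_td sub_dom_open (chart_rep_td 2). Qed.

Lemma pushforward_rank x : sub_dom x -> \rank (Defs.pushforward F i j x) = m.
Proof.
by case=> q [iq jq] <-; have [_ _ /(_ i j q iq jq)[]] := hF.
Qed.

Let gs x : sub_dom x -> (gM i x)^T = gM i x.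
Proof. by move=> /sub_dom_img; exact: gram_sym. Qed.

Let gp x : sub_dom x -> forall v, v != 0 -> 0 < ip (gM i x) v v.
Proof. by move=> /sub_dom_img; exact: gram_pos. Qed.

Lemma ver_mxE x : sub_dom x -> proj_mx (ver_mx F i j x) (hor_mx gM F i j x) =
  vproj (gM i x) (Defs.pushforward F i j x).
Proof. by move=> Dx; exact: proj_verE (gs Dx) (gp Dx)
  (pushforward_rank Dx). Qed.

Lemma hor_mxE x : sub_dom x -> proj_mx (hor_mx gM F i j x) (ver_mx F i j x) =
  1%:M - vproj (gM i x) (Defs.pushforward F i j x).
Proof. by move=> Dx; exact: proj_horE (gs Dx) (gp Dx)
  (pushforward_rank Dx). Qed.

Lemma oneill_T_vertical x u v : sub_dom x -> vertical F i j x u ->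
  vertical F i j x v ->
  oneill_T gM F i j x u v = oneill_ver (gM i) (Defs.pushforward F i j) x u v.
Proof.
move=> Dx uJ vJ.
have g2 := td_subset sub_dom_img (gram_smooth gM i 2).
have H := oneill_verE sub_dom_open g2 gs gp pushforward_td pushforward_rank
  ver_mxE hor_mxE Dx uJ vJ.
exact: H.
Qed.

Section Fibre.
Variables (p : M) (W : set 'rV[R]_2) (s : 'rV[R]_2 -> 'rV[R]_n) (u0 : 'rV[R]_2).
Hypothesis hs : fibre_parametrization F i p W s u0.
Hypothesis jp : dom j (F p).
Hypothesis nE : n = (2 + m)%N.

Lemma fibre_sub_dom y : W y -> sub_dom (s y).
Proof.
move=> Wy; have [_ _ _ /(_ y Wy)[[q iq qs] Fs _]] := hs.
exists q => //; split=> //; rewrite /= -[q](chart_mapK iq) qs Fs.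
exact: jp.
Qed.

Let s3 : times_differentiable_on 3 W s. Proof. by have [_ h _ _] := hs;
  exact: h. Qed.
Let oW : open W. Proof. by have [[]] := hs. Qed.

(** F is constant on the fibre, so its chart representative is constant along [s]. *)
Lemma fibre_tangent y a : W y -> der a s y *m Defs.pushforward F i j (s y) = 0.
Proof.
move=> Wy; have Dy := fibre_sub_dom Wy.
have ds : differentiable s y by case: s3 => h _; exact: h.
have dc : differentiable (chart_rep F i j) (s y).
  by case: (chart_rep_td 1) => h _; exact: h.
rewrite /Defs.pushforward -deriveEjacobian// -(der_val (is_derive_comp ds dc
  (is_derive_der a ds))).
rewrite (near_der (f' := fun=> chart_map j (F p))) ?der_cst//.
have : \forall t \near y, W t by exact: open_nbhs_nbhs.
apply: filterS => t Wt; have [_ _ _ /(_ t Wt)[_ Fs _]] := hs.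
by rewrite /= /chart_rep /= Fs.
Qed.

Lemma fibre_span y v : W y -> v *m Defs.pushforward F i j (s y) = 0 ->
  exists a, v = der a s y.
Proof.
move=> Wy vJ; have Dy := fibre_sub_dom Wy.
have [_ _ _ /(_ y Wy)[_ _ rs]] := hs.
have [|a ->] := kernel_span nE rs (pushforward_rank Dy) _ vJ.
  apply/row_matrixP => k; rewrite row0 row_mul rowE -(der_jacobian s3)//.
  exact: fibre_tangent.
by exists a; rewrite (der_jacobian s3).
Qed.

Lemma fibre_metric_pos y a : W y -> a != 0 ->
  0 < ip (pullback_metric (gM i) s y) a a.
Proof.
move=> Wy a0; rewrite (ip_pullback _ s3)//; apply: gp;
  first exact: fibre_sub_dom.
have [_ _ _ /(_ y Wy)[_ _ rs]] := hs.
have fJ : row_free (jacobian s y) by rewrite /row_free rs.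
apply: contraNneq a0; rewrite (der_jacobian s3)// => h.
by apply/eqP/(row_free_inj fJ); rewrite h mul0mx.
Qed.

End Fibre.
End SubmersionCharts.

(** * From the slant angle to lengths of projections *)

Section SlantAngle.
Context {R : realType} {n m : nat} {M : manifold R n} {N : manifold R m}.
Variables (S : almost_contact_metric M) (gN : metric N) (F : M -> N).
Variables (theta : R) (i : chart M) (j : chart N).
Hypothesis hF : riemannian_submersion S gN F.
Hypothesis hxi : xi_horizontal S F.
Hypothesis hslant : proper_slant S F theta.
Local Notation G := (gram S i).
Local Notation ph := (Defs.phi S i).
Local Notation J := (Defs.pushforward F i j).
Local Notation D := (sub_dom F i j).

Lemma xi_vertical y v : D y -> v *m J y = 0 -> ip (G y) v (Defs.xi S i y) = 0.
Proof. by move=> [q [iq jq] <-] vJ; exact: (hxi iq jq vJ). Qed.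

(** A nonzero vertical [v] identifies [theta] as the value of [acos] at |psi v| / |phi v|, which
    lies in [0, 1]; this gives its cosine, and properness then excludes the two end values. *)
Lemma slant_angle y v : D y -> v *m J y = 0 -> v != 0 ->
  [/\ ip (G y) (v *m ph y *m vproj (G y) (J y)) (v *m ph y *m vproj (G y) (J y))
        = cos theta ^+ 2 * ip (G y) v v,
      cos theta != 0 & sin theta != 0].
Proof.
move=> Dy vJ v0; have iy := sub_dom_img Dy.
have Gs := gram_sym S iy; have Gp := gram_pos S iy.
set w := v *m ph y; set z := w *m vproj (G y) (J y).
have zJ : z *m J y = 0 by exact: vproj_vertical Gs Gp
  (pushforward_rank hF Dy) _.
have wz : ip (G y) w z = ip (G y) z z.
  by rewrite /z (ip_vproj _ Gs Gp) [in RHS]vproj_id.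
have ww : ip (G y) w w = ip (G y) v v.
  rewrite /w (phi_skew_ip _ _ _ iy) (phi_phi_ip _ _ iy) ipDr ipNr ipZr.
  by rewrite (xi_vertical Dy vJ) mulr0 addr0 opprK.
have a0 : 0 < ip (G y) w w by rewrite ww Gp.
have nn u : 0 <= ip (G y) u u.
  by have [->|/Gp/ltW//] := eqVneq u 0; rewrite ip0l.
have b0 := nn z; have := nn (w - z).
rewrite ipBl !ipBr (ip_sym z w Gs) wz => ba.
have : angle (G y) w z = theta.
  have [hs _ _] := hslant; case: Dy => q [iq jq] qy.
  have := hs i j q iq jq v v0; rewrite /= qy => /(_ vJ) <-.
  rewrite /psi /ver_proj (ver_mxE hF)//; by exists q.
rewrite /angle wz; set a := ip _ w w; set b := ip _ z z.
rewrite -/a in a0 ww ba; rewrite -/b in b0 ba.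
(* For b = 0 the left side is 0 / 0 = 0, in agreement with the angle pi / 2 of the zero vector. *)
have -> : b / (Num.sqrt a * Num.sqrt b) = Num.sqrt (b / a).
  have [b_0|bn0] := eqVneq b 0.
    by rewrite b_0 !mul0r sqrtr0.
  have sa : Num.sqrt a != 0 by rewrite gt_eqF// sqrtr_gt0.
  have bp : 0 < b by rewrite lt_def bn0.
  have sb : Num.sqrt b != 0 by rewrite gt_eqF// sqrtr_gt0.
  rewrite sqrtrM// sqrtrV ?ltW// -{1}(sqr_sqrtr b0); by field; rewrite sa sb.
have q0 : 0 <= b / a by rewrite divr_ge0// ltW.
have q1 : b / a <= 1 by rewrite ler_pdivrMr// mul1r; lra.
set q := Num.sqrt (b / a).
have qq : q ^+ 2 = b / a by rewrite sqr_sqrtr.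
have qge : 0 <= q by exact: sqrtr_ge0.
have qle : q <= 1 by rewrite -(@ler_pXn2r _ 2)// ?nnegrE// expr1n qq.
move=> ha; have cq : cos theta = q.
  by rewrite -ha acosK// in_itv/=; apply/andP; split => //; lra.
have [_ t0 tpi] := hslant.
have c0 : cos theta != 0.
  by apply: contra_neq tpi => c0; rewrite -ha -/q -cq c0 acos0.
split => //.
  by rewrite cq qq -ww divfK// gt_eqF.
(* If sin theta = 0 then cos theta, being nonnegative, is 1, and theta = acos 1 = 0. *)
apply: contra_neq t0 => s0.
have := cos2Dsin2 theta; rewrite s0 expr0n addr0 cq => /eqP.
by rewrite sqrp_eq1// => /eqP q_1; rewrite -ha -/q q_1 acos1.
Qed.

End SlantAngle.

(** * Curvature and second fundamental form of the slant fibres *)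

Section Fibres.
Context {R : realType} {M : manifold R 5} {N : manifold R 3}.
Variables (S : almost_contact_metric M) (gN : metric N) (F : M ->
  N) (c theta : R).
Variables (p : M) (i : chart M) (j : chart N).
Hypothesis hM : cosymplectic_space_form S c.
Hypothesis hF : riemannian_submersion S gN F.
Hypothesis hxi : xi_horizontal S F.
Hypothesis hslant : proper_slant S F theta.
Hypothesis hj : dom j (F p).
Variables (W : set 'rV[R]_2) (s : 'rV[R]_2 -> 'rV[R]_5) (u0 : 'rV[R]_2).
Hypothesis hs : fibre_parametrization F i p W s u0.
Local Notation x := (chart_map i p).
Local Notation G := (gram S i).
Local Notation ph := (Defs.phi S i).
Local Notation xi_i := (Defs.xi S i).
Local Notation J := (Defs.pushforward F i j).
Local Notation D := (sub_dom F i j).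
Local Notation T := (oneill_ver G J x).
Local Notation gh := (pullback_metric G s).
Local Notation II := (second_fundamental G s).
Local Notation e0 := (basis_vec 0 : 'rV[R]_2).
Local Notation e1 := (basis_vec 1 : 'rV[R]_2).
Implicit Types u v w : 'rV[R]_5.

Let oD : open D := sub_dom_open hF.
Let G2 : times_differentiable_on 2 D G := td_subset
  (@sub_dom_img _ _ _ _ _ F i j) (gram_smooth S i 2).
Let ph2 : times_differentiable_on 2 D ph := td_subset
  (@sub_dom_img _ _ _ _ _ F i j) (phi_smooth S i 2).
Let xi1 : times_differentiable_on 1 D xi_i := td_subset
  (@sub_dom_img _ _ _ _ _ F i j) (xi_smooth S i 1).
Let Gs y : D y -> (G y)^T = G y. Proof. by move=> /sub_dom_img;
  exact: gram_sym. Qed.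
Let Gp y : D y -> forall v, v != 0 -> 0 < ip (G y) v v.
Proof. by move=> /sub_dom_img; exact: gram_pos. Qed.
Let Gu y : D y -> G y \in unitmx. Proof. by move=> /Gp; exact: pos_unitmx. Qed.
Let J1 : times_differentiable_on 1 D J := pushforward_td _ _ hF.
Let rJ y : D y -> \rank (J y) = 3%N. Proof. by move=> Dy;
  exact: (pushforward_rank hF Dy). Qed.
Let skew y v w : D y -> ip (G y) (v *m ph y) w = - ip (G y) v (w *m ph y).
Proof. by move=> /sub_dom_img; exact: phi_skew_ip. Qed.
Let phph y v : D y -> v *m ph y *m ph y = - v + ip (G y) v (xi_i y) *: xi_i y.
Proof. by move=> /sub_dom_img; exact: phi_phi_ip. Qed.
Let xiph y : D y -> xi_i y *m ph y = 0.
Proof. by move=> /sub_dom_img; exact: phi_xi. Qed.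

Let deta y u v : D y ->
  der u (fun z => ip (G z) v (xi_i z)) y = der v (fun z =>
    ip (G z) u (xi_i z)) y.
Proof. by move=> /sub_dom_img iy; have [[_ h _] _] := hM; exact: deta_cst. Qed.

Let dPhi y u v w : D y ->
  der u (fun z => ip (G z) v (w *m ph z)) y
  + der v (fun z => ip (G z) w (u *m ph z)) y
  + der w (fun z => ip (G z) u (v *m ph z)) y = 0.
Proof. by move=> /sub_dom_img iy; have [[_ _ h] _] := hM; exact: dPhi_cst. Qed.

Let nij y u v : D y ->
  v *m der (u *m ph y) ph y - u *m der (v *m ph y) ph y
  + u *m der v ph y *m ph y - v *m der u ph y *m ph y = 0.
Proof. by move=> /sub_dom_img iy; have [[h h' _] _] := hM;
  exact: nijenhuis_cst. Qed.

Let par y u v : D y ->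
  v *m der u ph y = chr G y u v *m ph y - chr G y u (v *m ph y).
Proof.
move=> Dy; exact: (parallel_phi oD G2 Gs Gu ph2 xi1 phph xiph skew deta dPhi
  nij).
Qed.

Let riem_ph y u v w : D y -> riem G y u v (w *m ph y) = riem G y u v w *m ph y.
Proof.
move=> Dy; exact: (riem_phi oD G2 Gs Gu ph2 xi1 phph xiph skew deta dPhi nij).
Qed.

(** phi squares to -1 on vectors orthogonal to xi only, so these form the domain predicate in the
    algebraic lemma. *)
Lemma sectional_cosymplectic y u v : D y ->
  ip (G y) u (xi_i y) = 0 -> ip (G y) v (xi_i y) = 0 ->
  ip (G y) (riem G y u v v) u = c / 4 * (ip (G y) u u * ip (G y) v v
    - ip (G y) u v ^+ 2 + 3 * ip (G y) u (v *m ph y) ^+ 2).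
Proof.
move=> Dy uxi vxi.
pose K a b d e := ip (G y) (riem G y a b d) e.
apply: (@space_form_curvature _ _ K _ _ _ _ (fun w => w *m ph y)
   (fun w => ip (G y) w (xi_i y) = 0) _ _ _ _ _ (ip (G y)) c) => //.
- by move=> b d e a w w'; rewrite /K (riem_linear1 oD G2 Gs Gu)// ipDl ipZl.
- by move=> a b d e; rewrite /K (riem_skew12 oD G2 Gs Gu)// ipNl.
- by move=> a b d e; rewrite /K (riem_skew34 oD G2 Gs Gu).
- by move=> a b d e; rewrite /K -!ipDl (riem_bianchi oD G2 Gs Gu)// ip0l.
- by move=> a b; rewrite mulmxDl.
- by move=> a; rewrite mulNmx.
- by move=> a _; rewrite skew// xiph// ip0r oppr0.
- by move=> a a0; rewrite phph// a0 scale0r addr0.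
- move=> a b d e _ e0'; rewrite /K riem_ph// skew// phph// e0' scale0r addr0.
  by rewrite ipNr opprK.
- by move=> a b; rewrite ip_sym// Gs.
- by move=> a b d; rewrite ipDl.
- by move=> a b d; rewrite ipZl.
- move=> a b _ b0; rewrite skew// phph// b0 scale0r addr0 ipNr opprK.
  by [].
- by move=> a; exact: Gp.
- by move=> a b; rewrite -scalemxAl.
- by move=> a b a0 b0; rewrite ipDl a0 b0 addr0.
- by move=> a b b0; rewrite ipZl b0 mulr0.
move=> E E0 E1; have [_ h] := hM.
by rewrite -(h i y E (sub_dom_img Dy) E1 E0) /K /phi_sectional !riemE.
Qed.

Let W0 : W u0. Proof. by have [[]] := hs. Qed.
Let oW : open W. Proof. by have [[]] := hs. Qed.
Let s3 : times_differentiable_on 3 W s. Proof. by have [_ h _ _] := hs;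
  exact: h. Qed.
Let su0 : s u0 = x. Proof. by have [] := hs. Qed.
Let sWD y : W y -> D (s y). Proof. by move=> Wy;
  exact: (fibre_sub_dom hs hj Wy). Qed.
Let stan y a : W y -> der a s y *m J (s y) = 0.
Proof. by move=> Wy; exact: (fibre_tangent hF hs hj a Wy). Qed.
Let sspan y v : W y -> v *m J (s y) = 0 -> exists a, v = der a s y.
Proof. by move=> Wy; exact: (fibre_span hF hs hj erefl Wy). Qed.
Let ghp y : W y -> forall a, a != 0 -> 0 < ip (gh y) a a.
Proof. by move=> Wy a; exact: (fibre_metric_pos S hs hj Wy). Qed.
Let ghu y : W y -> gh y \in unitmx.
Proof. by move=> Wy; exact: pos_unitmx (ghp Wy). Qed.
Let Dx : D x. Proof. by rewrite -su0; exact: sWD. Qed.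

Let TII a b : T (der a s u0) (der b s u0) = II a b u0.
Proof.
rewrite -su0.
exact: (oneill_ver_fibre oD G2 Gs Gp J1 rJ oW s3 sWD stan sspan ghu).
Qed.

Let ght : times_differentiable_on 2 W gh.
Proof. exact: (pullback_metric_td oD G2 oW s3 sWD). Qed.

Let span u : u *m J x = 0 -> exists a, u = der a s u0.
Proof. by rewrite -su0; exact: sspan. Qed.

Lemma oneill_ver_sym u v : u *m J x = 0 -> v *m J x = 0 -> T u v = T v u.
Proof.
have ghs y : W y -> (gh y)^T = gh y.
  by move=> Wy; exact: (pullback_metric_sym Gs sWD Wy).
move=> /span[a ->] /span[b ->]; rewrite !TII !second_fundamentalE.
rewrite (cov_velocityC oD G2 Gs Gu oW s3 sWD a b W0).
by rewrite (christoffelC oW ght ghs ghu a b W0).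
Qed.

Let Tlin2 u a : T u (der a s u0) =
  a 0 0 *: T u (der e0 s u0) + a 0 1 *: T u (der e1 s u0).
Proof.
have Tr := oneill_ver_linearr J G2 Gp u Dx.
have T0 : T u 0 = 0 by have := Tr (-1) 0 0;
  rewrite scaler0 addr0 scaleN1r addNr.
rewrite (der2 s3 a W0) Tr; congr (_ + _).
by have := Tr (a 0 1) (der e1 s u0) 0; rewrite T0 !addr0.
Qed.

Let Tlin2l u a : T (der a s u0) u =
  a 0 0 *: T (der e0 s u0) u + a 0 1 *: T (der e1 s u0) u.
Proof.
have Tl := oneill_ver_linearl oD G2 Gs Gp J1 rJ u Dx.
have T0 : T 0 u = 0 by have := Tl (-1) 0 0;
  rewrite scaler0 addr0 scaleN1r addNr.
rewrite (der2 s3 a W0) Tl; congr (_ + _).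
by have := Tl (a 0 1) (der e1 s u0) 0; rewrite T0 !addr0.
Qed.

Hypothesis cos0 : cos theta != 0.

Let slant_v y v : D y -> v *m J y = 0 ->
  ip (G y) (v *m ph y *m vproj (G y) (J y)) (v *m ph y *m vproj (G y) (J y))
  = cos theta ^+ 2 * ip (G y) v v.
Proof.
move=> Dy vJ; have [->|v0] := eqVneq v 0; first by rewrite !mul0mx !ip0l mulr0.
by have [] := slant_angle hF hxi hslant Dy vJ v0.
Qed.

Lemma oneill_ver_slant u v w : u *m J x = 0 -> v *m J x = 0 -> w *m J x = 0 ->
  ip (G x) (T u v) (w *m ph x) = ip (G x) (T u w) (v *m ph x).
Proof.
move=> /span[a ->] /span[b ->] /span[d ->].
have := slant_second_fundamental oD G2 Gs Gp rJ (td_pred ph2) skew par slant_v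
  cos0 oW s3 sWD stan sspan ghp a W0.
rewrite su0 -!TII => sl.
rewrite !(Tlin2 _ b) !(Tlin2 _ d) (der2 s3 b W0) (der2 s3 d W0).
rewrite !mulmxDl -!scalemxAl !(ipDl, ipDr, ipZl, ipZr) sl.
ring.
Qed.

(** The Gauss equation gives [tau] in the coordinate frame of the parametrization, whereas [u1],
    [u2] is an arbitrary orthonormal basis of the vertical space; what remains is a change of
    basis. *)
Lemma fibre_scalar_curvature tau u1 u2 :
  tau = sectional (induced_metric S i s) u0 (basis_vec 0) (basis_vec 1) ->
  u1 *m J x = 0 -> u2 *m J x = 0 ->
  ip (G x) u1 u1 = 1 -> ip (G x) u2 u2 = 1 -> ip (G x) u1 u2 = 0 ->
  tau = c / 4 * (1 + 3 * cos theta ^+ 2) + ip (G x) (T u1 u1) (T u2 u2)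
        - ip (G x) (T u1 u2) (T u1 u2).
Proof.
have -> : induced_metric S i s = gh.
  by apply/funext => y; rewrite pullback_metricE.
rewrite /sectional -riemE (gauss_equation oD G2 Gs Gu oW s3 sWD ghu)//.
rewrite !(ip_pullback _ s3)// -!TII.
have v0 : der e0 s u0 *m J x = 0 by rewrite -su0; exact: stan.
have v1 : der e1 s u0 *m J x = 0 by rewrite -su0; exact: stan.
rewrite su0 sectional_cosymplectic//;
  [|exact: (xi_vertical hxi Dx v0)|exact: (xi_vertical hxi Dx v1)].
(* Replaces the squared product of phi s_1 and s_2 by cos^2 theta times the Gram determinant of the
   frame. *)
have := slant_area Gs Gp rJ skew slant_v s3 sWD stan sspan ghp W0.
have := fibre_area_gt0 Gs s3 sWD ghp W0.
rewrite su0 skew//.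
set S0 := der e0 s u0; set S1 := der e1 s u0.
set g11 := ip _ S0 S0; set g12 := ip _ S0 S1; set g22 := ip _ S1 S1.
set f := ip _ S0 (S1 *m _).
rewrite sqrrN => area0 area tauE.
move=> /span[a ->] /span[b ->].
rewrite (oneill_ver_sym v1 v0) in tauE.
rewrite !(Tlin2 _ a) !(Tlin2 _ b) !(Tlin2l _ a) !(Tlin2l _ b).
rewrite (oneill_ver_sym v1 v0) (der2 s3 a W0) (der2 s3 b W0) -/S0 -/S1.
set t00 := T S0 S0; set t01 := T S0 S1; set t11 := T S1 S1.
have gC u v : ip (G x) u v = ip (G x) v u by exact: ip_sym (Gs Dx).
rewrite !(ipDl, ipDr, ipZl, ipZr) (gC S1 S0) (gC t11 t00) (gC t01 t00)
  (gC t11 t01).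
rewrite -/g11 -/g12 -/g22.
move: (a 0 0) (a 0 1) (b 0 0) (b 0 1) => a0 a1 b0 b1 h11 h22 h12.
set Del := g11 * g22 - g12 ^+ 2 in area0 area tauE.
(* The squared determinant of the coordinates of an orthonormal basis is the inverse of the Gram
   determinant of the frame. *)
have dD : (a0 * b1 - a1 * b0) ^+ 2 * Del = 1.
  have := congr2 *%R h11 h22; have := congr1 (fun z => z ^+ 2) h12.
  rewrite /= [0 ^+ 2]expr2 mulr0 mulr1 /Del => m1 m2; lra.
have DI : Del^-1 = (a0 * b1 - a1 * b0) ^+ 2.
  by apply: (mulIf (lt0r_neq0 area0)); rewrite mulVf ?dD// gt_eqF.
rewrite -/S0 -/S1 -/t00 -/t01 -/t11 area DI (gC t11 t00) in tauE; rewrite tauE.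
move: (ip _ t00 t00) (ip _ t00 t01) (ip _ t00 t11) (ip _ t01 t01)
  (ip _ t01 t11) (ip _ t11 t11) => z1 z2 z3 z4 z5 z6.
(* [z3 - z4] is the value of <T11, T22> - |T12|^2 in the coordinate frame; it scales by the squared
   determinant. *)
transitivity (c / 4 * (1 + 3 * cos theta ^+ 2) *
  ((a0 * b1 - a1 * b0) ^+ 2 * Del)
  + (z3 - z4) * (a0 * b1 - a1 * b0) ^+ 2); first by ring.
by rewrite dD; ring.
Qed.

End Fibres.

(** * The inequality for the mean curvature vector and its equality case *)

Section MeanCurvatureInequality.
Context {R : realType} {n : nat} (b : 'M[R]_n).
Hypothesis bsym : b^T = b.
Hypothesis bpos : forall v, v != 0 -> 0 < ip b v v.
Variables t11 t12 t22 : 'rV[R]_n.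

Let nonneg v : 0 <= ip b v v.
Proof. by have [->|/bpos/ltW//] := eqVneq v 0; rewrite ip0l. Qed.

(** The factor 8 clears the quarter and doubles the gap, so that the product of [t11] and [t22] is
    absorbed in |t11 + t22|^2 and only squares remain. *)
Lemma mean_curvature_gap :
  let h := 2^-1 *: (t11 + t22) in
  8 * (ip b h h - 4^-1 * (ip b t11 t22 - ip b t12 t12)) =
  ip b t11 t11 + ip b t22 t22 + ip b (t11 + t22) (t11 + t22) + 2 * ip b t12 t12.
Proof.
by rewrite /= !(ipZl, ipZr, ipDl, ipDr) (ip_sym t22 t11 bsym); field.
Qed.

Lemma mean_curvature_ge :
  let h := 2^-1 *: (t11 + t22) in
  4^-1 * (ip b t11 t22 - ip b t12 t12) <= ip b h h.
Proof.
have := mean_curvature_gap; have := nonneg t11; have := nonneg t22.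
by have := nonneg t12; have := nonneg (t11 + t22) => /= *; lra.
Qed.

Lemma mean_curvature_eq :
  let h := 2^-1 *: (t11 + t22) in
  ip b h h = 4^-1 * (ip b t11 t22 - ip b t12 t12) ->
  [/\ t11 = 0, t12 = 0 & t22 = 0].
Proof.
have := mean_curvature_gap; have := nonneg t11; have := nonneg t22.
have := nonneg t12; have := nonneg (t11 + t22) => /= p1 p2 p3 p4 gap e.
have null v : ip b v v = 0 -> v = 0.
  by move=> v0; apply/eqP/negbNE/negP => /bpos; rewrite v0 ltxx.
by split; apply: null; lra.
Qed.

End MeanCurvatureInequality.

Theorem theorem15 (R : realType) (M : manifold R 5) (N : manifold R 3)
  (S : almost_contact_metric M) (gN : metric N) (F : M -> N) (c theta : R)
  (hM : cosymplectic_space_form S c)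
  (hF : riemannian_submersion S gN F)
  (hxi : xi_horizontal S F)
  (hslant : proper_slant S F theta)
  (p : M) (i : chart M) (j : chart N) (hi : dom i p) (hj : dom j (F p))
  (h : 'rV[R]_5) (hh : is_mean_curvature S F i j (chart_map i p) h)
  (tau : R) (htau : is_fibre_scalar_curvature S F i p tau) :
  let x := chart_map i p in
  let normH2 := ip (S i x) h h in
  let bound := 4^-1 * (tau - c / 4 * (1 + 3 * cos theta ^+ 2)) in
  normH2 >= bound /\
  (normH2 = bound <->
   exists e1 e2 e3 e4 e5 : 'rV[R]_5,
     slant_orthonormal_basis S F theta i j x e1 e2 e3 e4 e5 /\
     let T u v w := ip (S i x) (oneill_T S F i j x u v) w in
     [/\ T e1 e1 e4 = - T e2 e2 e4,
         [/\ T e1 e1 e3 = 0, T e1 e2 e3 = 0 & T e2 e2 e3 = 0]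
       & [/\ T e1 e1 e5 = 0, T e1 e2 e5 = 0, T e2 e1 e5 = 0
           & T e2 e2 e5 = 0]]).
Proof.
move=> x normH2 bound.
have [U1 [U2 [[v1 v2] [n1 n2 n12] hE]]] := hh.
have [W [s [u0 [hs tauE]]]] := htau.
set J := Defs.pushforward F i j x.
have Dx : sub_dom F i j x by exists p.
have ix := sub_dom_img Dx.
have Gs := gram_sym S ix; have Gp := gram_pos S ix.
have rJ : \rank J = 3%N := pushforward_rank hF Dx.
set T := oneill_ver (S i) (Defs.pushforward F i j) x.
have TE u v : u *m J = 0 -> v *m J = 0 -> oneill_T S F i j x u v = T u v.
  by move=> uJ vJ; exact: (oneill_T_vertical hF Dx uJ vJ).
have xi_hor v (vJ : v *m J = 0) := xi_vertical hxi Dx vJ.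
(* A nonzero vertical vector at the point turns properness into cos theta and sin theta being
   nonzero. *)
have U10 : U1 != 0.
  by apply/eqP => U10; move/eqP: n1; rewrite U10 ip0l eq_sym oner_eq0.
have [_ c0 s0] := slant_angle hF hxi hslant Dx v1 U10.
have slant_v v : v *m J = 0 ->
    ip (S i x) (v *m Defs.phi S i x *m vproj (S i x) J)
      (v *m Defs.phi S i x *m vproj (S i x) J) = cos theta ^+ 2 * ip
        (S i x) v v.
  move=> vJ; have [->|v0] := eqVneq v 0; first by rewrite !mul0mx !ip0l mulr0.
  by have [] := slant_angle hF hxi hslant Dx vJ v0.
have skew v w := phi_skew_ip S v w ix.
have phph v := phi_phi_ip S v ix.
have G2 := td_subset (@sub_dom_img _ _ _ _ _ F i j) (gram_smooth S i 2).
have Gs' y : sub_dom F i j y -> (S i y)^T = S i y.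
  by move=> /sub_dom_img; exact: gram_sym.
have Gp' y : sub_dom F i j y -> forall v, v != 0 -> 0 < ip (S i y) v v.
  by move=> /sub_dom_img; exact: gram_pos.
have rJ' y : sub_dom F i j y -> \rank (Defs.pushforward F i j y) = 3%N.
  by move=> Dy; exact: (pushforward_rank hF Dy).
have oD : open (sub_dom F i j) := sub_dom_open hF.
have Tl v : linear (fun u => T u v).
  have lin := oneill_ver_linearl oD G2 Gs' Gp' (pushforward_td i j hF) rJ' v Dx.
  exact: lin.
have Tr u : linear (T u) := oneill_ver_linearr
  (Defs.pushforward F i j) G2 Gp' u Dx.
have TC u v (uJ : u *m J = 0) (vJ : v *m J = 0) : T u v = T v u.
  exact: (oneill_ver_sym hF hj hs uJ vJ).
have T_hor u v w (wJ : w *m J = 0) : ip (S i x) (T u v) w = 0.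
  exact: (oneill_ver_horizontal Gs' Gp' u v Dx wJ).
have T_slant u v w (uJ : u *m J = 0) (vJ : v *m J = 0) (wJ : w *m J = 0) :
    ip (S i x) (T u v) (w *m Defs.phi S i x) = ip (S i x) (T u w)
      (v *m Defs.phi S i x).
  exact: (oneill_ver_slant hM hF hxi hslant hj hs c0 uJ vJ wJ).
have tauT := fibre_scalar_curvature hM hF hxi hslant hj hs tauE v1 v2 n1 n2 n12.
(* The ambient curvature cancels, leaving an expression in T alone. *)
have boundE : bound = 4^-1 * (ip (S i x) (T U1 U1) (T U2 U2)
    - ip (S i x) (T U1 U2) (T U1 U2)).
  by rewrite /bound tauT; congr (_ * _); rewrite -/T; ring.
rewrite TE// TE// in hE.
rewrite /normH2 hE boundE.
have psiE v : psi S F i j x v = v *m Defs.phi S i x *m vproj (S i x) J.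
  by rewrite /psi /ver_proj (ver_mxE hF).
have omE v : omega S F i j x v = v *m Defs.phi S i x *m (1%:M - vproj
  (S i x) J).
  by rewrite /omega /hor_proj (hor_mxE hF).
split; first exact: mean_curvature_ge.
split=> [/(mean_curvature_eq Gs Gp)[t11 t12 t22]|].
  have T0 v w (vJ : v *m J = 0) (wJ : w *m J = 0) : T v w = 0.
    exact: (vanish_of_orthonormal Gs rJ Tl Tr TC v1 v2 n1 n2 n12 t11 t12 t22).
  (* [U1], from the frame defining the mean curvature, starts the slant basis; as T = 0, all
     conditions on components hold. *)
  pose e2 := (cos theta)^-1 *: psi S F i j x U1.
  have e2J : e2 *m J = 0.
    by rewrite /e2 psiE -scalemxAl (vproj_vertical Gs Gp rJ) scaler0.
  exists U1, e2, ((sin theta)^-1 *: omega S F i j x U1),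
    ((sin theta)^-1 *: omega S F i j x e2), (xi S i x).
  split; last by rewrite /= !TE// !T0// !ip0l oppr0.
  split; first by [].
  have := slant_basis_orthonormal Gs Gp rJ skew phph (phi_xi S ix)
    (xi_unit S ix)
    xi_hor slant_v c0 s0 (cos2Dsin2 theta) v1 n1.
  by rewrite /= /e2 !omE !psiE.
move=> [e1 [e2 [e3 [e4 [e5 [[[e1J e2E e3E e4E e5E] on] /= [t4 [t113 t123 t223]
  [t115 t125 _ t225]]]]]]]].
have e11 : ip (S i x) e1 e1 = 1 := on (@Ordinal 5 0 isT) (@Ordinal 5 0 isT).
have e2J : e2 *m J = 0.
  by rewrite e2E psiE -scalemxAl (vproj_vertical Gs Gp rJ) scaler0.
rewrite !TE// in t4 t113 t123 t223 t115 t125 t225.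
have T0 v w (vJ : v *m J = 0) (wJ : w *m J = 0) : T v w = 0.
  have := vanish_of_slant_basis Gs Gp rJ skew phph (phi_xi S ix) (xi_unit S ix)
    xi_hor slant_v c0 s0 (cos2Dsin2 theta) Tl Tr T_hor TC T_slant e1J e11.
  rewrite /= -psiE -e2E -!omE -e3E -e4E -e5E => T0.
  exact: T0.
(* T = 0 makes both the mean curvature and the bound vanish. *)
by rewrite !T0// addr0 scaler0 !ip0l subrr mulr0.
Qed.
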